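(* Let $P\in\mathcal C\langle X\rangle$ be a quasi-identity of $M_n$ and let $c\in F\langle X\rangle$ be a central polynomial of $M_n$ with zero constant term. Then there exists $m\in\mathbb N$ such that $c^mP$ is a consequence of the Cayley–Hamilton identity, i.e. $c^mP\in(Q_n)$.
   Context: Let $F$ be a field of characteristic $0$, $n\ge1$, $M_n=M_n(F)$. Let $\mathcal C=F[x^{(k)}_{ij}:1\le i,j\le n,\ k\ge1]$, $X=\{x_1,x_2,\dots\}$ noncommuting indeterminates, $\mathcal C\langle X\rangle$ the free $\mathcal C$-algebra (quasi-polynomials), containing the free algebra $F\langle X\rangle$. Evaluation at $A_k=(a^{(k)}_{ij})\in M_n$ substitutes $A_k$ for $x_k$ and $a^{(k)}_{ij}$ for $x^{(k)}_{ij}$; a quasi-identity vanishes at all evaluations. A central polynomial of $M_n$ is $c\in F\langle X\rangle$ all of whose evaluations in $M_n$ are scalar matrices. Generic matrices $\xi_k=(x^{(k)}_{ij})\in M_n(\mathcal C)$; for monomials $\mathrm{tr}(x_{i_1}\cdots x_{i_r}):=\mathrm{tr}(\xi_{i_1}\cdots\xi_{i_r})\in\mathcal C$. $Q_n=\sum_{\sigma\in S_{n+1}}\epsilon_\sigma\phi_\sigma(x_1,\dots,x_n)$, where for $\sigma=(i_1,\dots,i_{k_1})\cdots(u_1,\dots,u_h)(s_1,\dots,s_k,n+1)$ (disjoint cycles, the one containing $n+1$ last) $\phi_\sigma=\mathrm{tr}(x_{i_1}\cdots x_{i_{k_1}})\cdots\mathrm{tr}(x_{u_1}\cdots x_{u_h})x_{s_1}\cdots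 x_{s_k}$. A T-ideal is an ideal of $\mathcal C\langle X\rangle$ closed under all simultaneous substitutions $x_k\mapsto H_k$, $x^{(k)}_{ij}\mapsto\Phi(H_k)_{ij}$, where $\Phi:\mathcal C\langle X\rangle\to M_n(\mathcal C)$ is the $\mathcal C$-algebra map with $x_k\mapsto\xi_k$; $(Q_n)$ is the T-ideal generated by $Q_n$. *)

(* Defs.v *)
(* Quasi-polynomials C<X>, C = F[x^(k)_ij], presented as the
   free algebra: syntax trees modulo the congruence of unital associative
   F-algebras in which the commuting variables x^(k)_ij are central. *)
From HB Require Import structures.
From mathcomp Require Import all_boot all_order all_fingroup all_algebra.
Set Implicit Arguments. Unset Strict Implicit. Unset Printing Implicit Defensive.
Import GRing.Theory.
Local Open Scope ring_scope.

Section QPoly.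
Variables (F : fieldType) (n : nat).

(* Noncommuting variable x_(k+1) is QVar k (0-indexed);
   commuting variable x^(k+1)_(i+1,j+1) is QCVar k i j. *)
Inductive quasipoly : Type :=
| QConst of F
| QCVar of nat & 'I_n & 'I_n
| QVar of nat
| QAdd of quasipoly & quasipoly
| QMul of quasipoly & quasipoly
| QOpp of quasipoly.

Inductive qeq : quasipoly -> quasipoly -> Prop :=
| qeq_refl p : qeq p p
| qeq_sym p q : qeq p q -> qeq q p
| qeq_trans p q r : qeq p q -> qeq q r -> qeq p r
| qeq_add p p' q q' : qeq p p' -> qeq q q' -> qeq (QAdd p q) (QAdd p' q')
| qeq_mul p p' q q' : qeq p p' -> qeq q q' -> qeq (QMul p q) (QMul p' q')
| qeq_opp p p' : qeq p p' -> qeq (QOpp p) (QOpp p')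
| qeq_addA p q r : qeq (QAdd p (QAdd q r)) (QAdd (QAdd p q) r)
| qeq_addC p q : qeq (QAdd p q) (QAdd q p)
| qeq_add0 p : qeq (QAdd (QConst 0) p) p
| qeq_addN p : qeq (QAdd (QOpp p) p) (QConst 0)
| qeq_mulA p q r : qeq (QMul p (QMul q r)) (QMul (QMul p q) r)
| qeq_mul1l p : qeq (QMul (QConst 1) p) p
| qeq_mul1r p : qeq (QMul p (QConst 1)) p
| qeq_mulDl p q r : qeq (QMul (QAdd p q) r) (QAdd (QMul p r) (QMul q r))
| qeq_mulDr p q r : qeq (QMul r (QAdd p q)) (QAdd (QMul r p) (QMul r q))
| qeq_constD a b : qeq (QAdd (QConst a) (QConst b)) (QConst (a + b))
| qeq_constM a b : qeq (QMul (QConst a) (QConst b)) (QConst (a * b))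
| qeq_const_central a p : qeq (QMul (QConst a) p) (QMul p (QConst a))
| qeq_cvar_central k i j p : qeq (QMul (QCVar k i j) p) (QMul p (QCVar k i j)).

Definition qsum (s : seq quasipoly) : quasipoly := foldr QAdd (QConst 0) s.
Definition qprod (s : seq quasipoly) : quasipoly := foldr QMul (QConst 1) s.
Definition qpow (p : quasipoly) (m : nat) : quasipoly := iter m (QMul p) (QConst 1).

(* Phi : C<X> -> M_n(C), x_k |-> generic matrix xi_k, entrywise. *)
Fixpoint Phi (p : quasipoly) (i j : 'I_n) : quasipoly :=
  match p with
  | QConst a => if i == j then QConst a else QConst 0
  | QCVar k a b => if i == j then QCVar k a b else QConst 0
  | QVar k => QCVar k i j
  | QAdd p q => QAdd (Phi p i j) (Phi q i j)
  | QMul p q => qsum [seq QMul (Phi p i l) (Phi q l j) | l <- enum 'I_n]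
  | QOpp p => QOpp (Phi p i j)
  end.

Definition qtr (p : quasipoly) : quasipoly := qsum [seq Phi p i i | i <- enum 'I_n].

Fixpoint qsubst (H : nat -> quasipoly) (p : quasipoly) : quasipoly :=
  match p with
  | QConst a => QConst a
  | QCVar k a b => Phi (H k) a b
  | QVar k => H k
  | QAdd p q => QAdd (qsubst H p) (qsubst H q)
  | QMul p q => QMul (qsubst H p) (qsubst H q)
  | QOpp p => QOpp (qsubst H p)
  end.

Fixpoint qeval (A : nat -> 'M[F]_n) (p : quasipoly) : 'M[F]_n :=
  match p with
  | QConst a => a%:M
  | QCVar k a b => (A k a b)%:M
  | QVar k => A k
  | QAdd p q => qeval A p + qeval A q
  | QMul p q => qeval A p *m qeval A q
  | QOpp p => - qeval A p
  end.

Definition quasi_identity (P : quasipoly) : Prop := forall A, qeval A P = 0.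

Fixpoint in_free_alg (p : quasipoly) : bool :=
  match p with
  | QConst _ => true
  | QCVar _ _ _ => false
  | QVar _ => true
  | QAdd p q | QMul p q => in_free_alg p && in_free_alg q
  | QOpp p => in_free_alg p
  end.

Definition central_poly (c : quasipoly) : Prop :=
  in_free_alg c /\ forall A, exists a : F, qeval A c = a%:M.

Fixpoint const_term (p : quasipoly) : F :=
  match p with
  | QConst a => a
  | QCVar _ _ _ => 0
  | QVar _ => 0
  | QAdd p q => const_term p + const_term q
  | QMul p q => const_term p * const_term q
  | QOpp p => - const_term p
  end.

End QPoly.

Arguments QConst {F n}.
Arguments QCVar {F n}.
Arguments QVar {F n}.

Section CH.
Variables (F : fieldType) (n : nat).
Local Notation qp := (quasipoly F n).

Definition cyc_word (s : 'S_(n.+1)) (i : 'I_(n.+1)) : seq 'I_(n.+1) :=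
  traject s i #|porbit s i|.

Definition cyc_leader (s : 'S_(n.+1)) (i : 'I_(n.+1)) : bool :=
  (ord_max \notin porbit s i) && [forall j in porbit s i, (i <= j)%N].

Definition varof (i : 'I_(n.+1)) : qp := QVar (nat_of_ord i).

Definition phi_perm (s : 'S_(n.+1)) : qp :=
  QMul (qprod [seq qtr (qprod (map varof (cyc_word s i)))
                | i <- enum 'I_(n.+1) & cyc_leader s i])
       (qprod (map varof (behead (cyc_word s ord_max)))).

Definition Qn : qp :=
  qsum [seq QMul (QConst ((-1) ^+ odd_perm s)) (phi_perm s) | s <- enum 'S_(n.+1)].

Inductive inTQ : qp -> Prop :=
| inTQ_gen : inTQ Qn
| inTQ_eq p q : qeq p q -> inTQ p -> inTQ q
| inTQ_zero : inTQ (QConst 0)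
| inTQ_add p q : inTQ p -> inTQ q -> inTQ (QAdd p q)
| inTQ_mull r p : inTQ p -> inTQ (QMul r p)
| inTQ_mulr r p : inTQ p -> inTQ (QMul p r)
| inTQ_subst (H : nat -> qp) p : inTQ p -> inTQ (qsubst H p).

End CH.

(* Main.v *)
Require Import Defs.
From Corelib Require Import Setoid.
From HB Require Import structures.
From mathcomp Require Import all_boot all_order all_fingroup all_algebra.
From mathcomp Require Import mpoly.
From mathcomp Require boolp.
Set Implicit Arguments. Unset Strict Implicit. Unset Printing Implicit Defensive.
Import GRing.Theory.
Local Open Scope ring_scope.

(* Let Phi : C<X> -> M_n(C) be evaluation at the generic matrices.  An element
   with Phi(a) = 0 satisfies a^n = 0 modulo (Q_n), since only the (n+1)-cycles
   contribute to Q_n(a, ..., a).  Write Phi(c) = g for a scalar g in C; then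
   c - g is nilpotent modulo (Q_n) and it suffices to kill P by a power of g,
   i.e. to show P = 0 in the quotient A of C<X> by the g-torsion modulo (Q_n).

   A power g^m satisfies g^m M_n(C) <= Phi(C<X>).  Take c homogeneous of degree
   d > 0.  Differentiating Phi(c) = g in the coordinates of x_k gives elements
   a_i, b_i of the image with sum_i a_i z b_i scalar for all z; hence, for
   w_k = sum_i b_i a_i, both w_k M_n(C) and M_n(C) w_k lie in the image, and so
   do all matrices multiplied by an entry of w_k x_k w_k.  Modulo these entries
   (w_k x_k)^2 = 0, so tr(w_k x_k) is nilpotent, and by Euler's formula
   sum_k tr(w_k x_k) = n d g.

   In A the scalar g is regular and h lifts g^m diag(0, ..., n-1).  The
   polynomial q with q(h) = 0 coming from Q_n has the form f(X, g^m), f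
   homogeneous over F.  If f(i, 1) <> 0 for some i < n, then multiplying q(h) = 0
   by lifts of matrix units shows that a power of g vanishes in A.  Otherwise
   q = X r with r(0) regular; E = r(h) satisfies h E = 0 and E^2 = r(0) E, and
   comparing q(h) = 0 with q(h + E p E) = 0 gives E p E = 0 whenever
   Phi(p) = 0.  Since E generates a regular element of A as an ideal, p = 0. *)

(** * Quotients by ideals of quasi-polynomials *)

Add Parametric Relation (F : fieldType) (n : nat) : (quasipoly F n) (@qeq F n)
  reflexivity proved by (@qeq_refl F n)
  symmetry proved by (@qeq_sym F n)
  transitivity proved by (@qeq_trans F n) as qeq_setoid.

Add Parametric Morphism (F : fieldType) (n : nat) : (@QAdd F n)
  with signature (@qeq F n) ==> (@qeq F n) ==> (@qeq F n) as QAdd_qeq.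
Proof. by move=> p p' Hp q q' Hq; apply: qeq_add. Qed.

Add Parametric Morphism (F : fieldType) (n : nat) : (@QMul F n)
  with signature (@qeq F n) ==> (@qeq F n) ==> (@qeq F n) as QMul_qeq.
Proof. by move=> p p' Hp q q' Hq; apply: qeq_mul. Qed.

Add Parametric Morphism (F : fieldType) (n : nat) : (@QOpp F n)
  with signature (@qeq F n) ==> (@qeq F n) as QOpp_qeq.
Proof. by move=> p p' Hp; apply: qeq_opp. Qed.

(** Classical equality and choice on syntax trees: forming the quotient by an arbitrary ideal
    requires a decidable equivalence on a choice type. *)
HB.instance Definition _ (F : fieldType) (n : nat) :=
  boolp.gen_eqMixin (quasipoly F n).
HB.instance Definition _ (F : fieldType) (n : nat) :=
  boolp.gen_choiceMixin (quasipoly F n).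

Section QIdeal.
Variables (F : fieldType) (n : nat).
Local Notation qp := (quasipoly F n).
Local Notation "p =q q" := (@qeq F n p q) (at level 70).

Lemma qeq_add0r (p : qp) : QAdd p (QConst 0) =q p.
Proof. by rewrite qeq_addC qeq_add0; reflexivity. Qed.

Lemma qeq_addNr (p : qp) : QAdd p (QOpp p) =q QConst 0.
Proof. by rewrite qeq_addC; apply: qeq_addN. Qed.

Lemma qeq_addI (p q r : qp) : QAdd p q =q QAdd p r -> q =q r.
Proof.
move=> H; rewrite -(qeq_add0 q) -(qeq_add0 r) -(qeq_addN p).
by rewrite -!qeq_addA H; reflexivity.
Qed.

Lemma qeq_mul0l (p : qp) : QMul (QConst 0) p =q QConst 0.
Proof.
apply: (@qeq_addI (QMul (QConst 0) p)).
rewrite -qeq_mulDl qeq_constD addr0 qeq_add0r; reflexivity.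
Qed.

Lemma qeq_oppE (p : qp) : QOpp p =q QMul (QConst (-1)) p.
Proof.
apply: (@qeq_addI p); rewrite qeq_addNr.
have H : QAdd (QMul (QConst 1) p) (QMul (QConst (-1)) p) =q QConst 0.
  by rewrite -qeq_mulDl qeq_constD addrN qeq_mul0l; reflexivity.
by rewrite -H qeq_mul1l; reflexivity.
Qed.

Lemma qeq_addACA (p q r s : qp) :
  QAdd (QAdd p q) (QAdd r s) =q QAdd (QAdd p r) (QAdd q s).
Proof.
rewrite -!qeq_addA; apply: qeq_add; first reflexivity.
by rewrite !qeq_addA (qeq_addC q r); reflexivity.
Qed.

Lemma qeq_oppD (p q : qp) : QOpp (QAdd p q) =q QAdd (QOpp p) (QOpp q).
Proof. by rewrite !qeq_oppE qeq_mulDr; reflexivity. Qed.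

Lemma qeq_oppK (p : qp) : QOpp (QOpp p) =q p.
Proof.
by apply: (@qeq_addI (QOpp p)); rewrite qeq_addNr qeq_addN; reflexivity.
Qed.

Lemma qeq_mulNr (p q : qp) : QMul p (QOpp q) =q QOpp (QMul p q).
Proof.
by rewrite !qeq_oppE !qeq_mulA -(qeq_const_central (-1) p); reflexivity.
Qed.

Lemma qeq_mulNl (p q : qp) : QMul (QOpp p) q =q QOpp (QMul p q).
Proof. by rewrite !qeq_oppE !qeq_mulA; reflexivity. Qed.

(** Properness is built in so that the quotient [qquot] is a nonzero ring and carries the structure
    [nzRingType]. *)
Record qideal := QIdeal {
  qi_mem :> qp -> Prop;
  qi_qeq : forall p q, p =q q -> qi_mem p -> qi_mem q;
  qi_zero : qi_mem (QConst 0);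
  qi_add : forall p q, qi_mem p -> qi_mem q -> qi_mem (QAdd p q);
  qi_mull : forall r p, qi_mem p -> qi_mem (QMul r p);
  qi_mulr : forall r p, qi_mem p -> qi_mem (QMul p r);
  qi_proper : ~ qi_mem (QConst 1) }.

Variable I : qideal.

Definition qi_rel (p q : qp) : bool := boolp.asbool (I (QAdd p (QOpp q))).

Lemma qi_relP p q : reflect (I (QAdd p (QOpp q))) (qi_rel p q).
Proof. exact: boolp.asboolP. Qed.

Lemma qi_opp p : I p -> I (QOpp p).
Proof. by move=> /(qi_mull (QConst (-1))); apply/qi_qeq/qeq_sym/qeq_oppE. Qed.

Lemma qi_rel_refl : reflexive qi_rel.
Proof.
by move=> p; apply/qi_relP/qi_qeq/qi_zero; rewrite qeq_addNr; reflexivity.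
Qed.

Lemma qi_rel_sym : ssrbool.symmetric qi_rel.
Proof.
have H p q : qi_rel p q -> qi_rel q p.
  move=> /qi_relP/qi_opp H; apply/qi_relP/qi_qeq/H.
  by rewrite qeq_oppD qeq_oppK qeq_addC; reflexivity.
by move=> p q; apply/idP/idP; apply: H.
Qed.

Lemma qi_rel_trans : transitive qi_rel.
Proof.
move=> q p r /qi_relP Hpq /qi_relP Hqr; apply/qi_relP/qi_qeq/(qi_add Hpq Hqr).
by rewrite -qeq_addA (qeq_addA (QOpp q)) qeq_addN qeq_add0; reflexivity.
Qed.

Canonical qi_equiv := EquivRel qi_rel qi_rel_refl qi_rel_sym qi_rel_trans.

Definition qquot := {eq_quot qi_equiv}%qT.
HB.instance Definition _ := Choice.on qquot.

Definition qpi (p : qp) : qquot := (\pi_qquot p)%qT.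
Definition qrep (x : qquot) : qp := generic_quotient.repr x.

Lemma qrepK x : qpi (qrep x) = x.
Proof. exact: reprK. Qed.

Lemma qpiP p q : qpi p = qpi q <-> I (QAdd p (QOpp q)).
Proof.
split=> [/eqquotP|] H; first exact/qi_relP.
by apply/eqquotP/qi_relP.
Qed.

Lemma qpi_qeq p q : p =q q -> qpi p = qpi q.
Proof. by move=> H; apply/qpiP/qi_qeq/qi_zero; rewrite H qeq_addNr; reflexivity. Qed.

Definition qq_add (x y : qquot) := qpi (QAdd (qrep x) (qrep y)).
Definition qq_mul (x y : qquot) := qpi (QMul (qrep x) (qrep y)).
Definition qq_opp (x : qquot) := qpi (QOpp (qrep x)).

Lemma qrep_qpi p : I (QAdd (qrep (qpi p)) (QOpp p)).
Proof. by apply/qpiP; rewrite qrepK. Qed.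

Lemma qq_addE p q : qq_add (qpi p) (qpi q) = qpi (QAdd p q).
Proof.
apply/qpiP/qi_qeq/(qi_add (qrep_qpi p) (qrep_qpi q)).
by rewrite qeq_oppD qeq_addACA; reflexivity.
Qed.

Lemma qq_oppE p : qq_opp (qpi p) = qpi (QOpp p).
Proof.
apply/qpiP/qi_qeq/(qi_opp (qrep_qpi p)).
by rewrite qeq_oppD; reflexivity.
Qed.

Lemma qq_mulE p q : qq_mul (qpi p) (qpi q) = qpi (QMul p q).
Proof.
apply/qpiP; set p' := qrep (qpi p); set q' := qrep (qpi q).
apply/qi_qeq/(qi_add (qi_mulr q' (qrep_qpi p)) (qi_mull p (qrep_qpi q))).
rewrite -/p' -/q' qeq_mulDl qeq_mulDr qeq_mulNl qeq_mulNr -!qeq_addA.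
by rewrite (qeq_addA _ _ (QOpp _)) qeq_addN qeq_add0; reflexivity.
Qed.

Lemma qpi_ind (P : qquot -> Prop) : (forall p, P (qpi p)) -> forall x, P x.
Proof. by move=> H x; rewrite -(qrepK x). Qed.

Lemma qq_addA : associative qq_add.
Proof.
elim/qpi_ind=> p; elim/qpi_ind=> q; elim/qpi_ind=> r.
by rewrite !qq_addE; apply: qpi_qeq; apply: qeq_addA.
Qed.

Lemma qq_addC : commutative qq_add.
Proof.
elim/qpi_ind=> p; elim/qpi_ind=> q.
by rewrite !qq_addE; apply: qpi_qeq; apply: qeq_addC.
Qed.

Lemma qq_add0 : left_id (qpi (QConst 0)) qq_add.
Proof. by elim/qpi_ind=> p; rewrite !qq_addE; apply: qpi_qeq; apply: qeq_add0. Qed.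

Lemma qq_addN : left_inverse (qpi (QConst 0)) qq_opp qq_add.
Proof.
by elim/qpi_ind=> p; rewrite qq_oppE qq_addE; apply: qpi_qeq; apply: qeq_addN.
Qed.

Lemma qq_mulA : associative qq_mul.
Proof.
elim/qpi_ind=> p; elim/qpi_ind=> q; elim/qpi_ind=> r.
by rewrite !qq_mulE; apply: qpi_qeq; apply: qeq_mulA.
Qed.

Lemma qq_mul1l : left_id (qpi (QConst 1)) qq_mul.
Proof. by elim/qpi_ind=> p; rewrite qq_mulE; apply: qpi_qeq; apply: qeq_mul1l. Qed.

Lemma qq_mul1r : right_id (qpi (QConst 1)) qq_mul.
Proof. by elim/qpi_ind=> p; rewrite qq_mulE; apply: qpi_qeq; apply: qeq_mul1r. Qed.

Lemma qq_mulDl : left_distributive qq_mul qq_add.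
Proof.
elim/qpi_ind=> p; elim/qpi_ind=> q; elim/qpi_ind=> r.
by rewrite !(qq_mulE, qq_addE); apply: qpi_qeq; apply: qeq_mulDl.
Qed.

Lemma qq_mulDr : right_distributive qq_mul qq_add.
Proof.
elim/qpi_ind=> p; elim/qpi_ind=> q; elim/qpi_ind=> r.
by rewrite !(qq_mulE, qq_addE); apply: qpi_qeq; apply: qeq_mulDr.
Qed.

Lemma qq_1neq0 : qpi (QConst 1) != qpi (QConst 0).
Proof.
apply/eqP => /qpiP H; apply: (@qi_proper I); apply: qi_qeq H.
rewrite qeq_oppE qeq_constM mulr0 qeq_add0r; reflexivity.
Qed.

HB.instance Definition _ := GRing.isNzRing.Build qquot
  qq_addA qq_addC qq_add0 qq_addN qq_mulA qq_mul1l qq_mul1r qq_mulDl qq_mulDr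
  qq_1neq0.

Lemma qpiD p q : qpi (QAdd p q) = qpi p + qpi q.
Proof. by rewrite -qq_addE. Qed.
Lemma qpiM p q : qpi (QMul p q) = qpi p * qpi q.
Proof. by rewrite -qq_mulE. Qed.
Lemma qpiN p : qpi (QOpp p) = - qpi p.
Proof. by rewrite -qq_oppE. Qed.
Lemma qpi0 : qpi (QConst 0) = 0. Proof. by []. Qed.

Lemma qpi_eq0 p : qpi p = 0 <-> I p.
Proof.
rewrite -qpi0 qpiP; split; apply: qi_qeq.
  by rewrite qeq_oppE qeq_constM mulr0 qeq_add0r; reflexivity.
by rewrite qeq_oppE qeq_constM mulr0 qeq_add0r; reflexivity.
Qed.

Lemma qpi_sum s : qpi (qsum s) = \sum_(p <- s) qpi p.
Proof. by elim: s => [|p s IH]; rewrite ?big_nil // big_cons -IH -qpiD. Qed.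

Lemma qpi_prod s : qpi (qprod s) = \prod_(p <- s) qpi p.
Proof. by elim: s => [|p s IH]; rewrite ?big_nil // big_cons -IH -qpiM. Qed.

Lemma qpi_pow p m : qpi (qpow p m) = qpi p ^+ m.
Proof. by elim: m => [|m IH] //=; rewrite exprS -IH -qpiM. Qed.

End QIdeal.

(** * Coefficients of the Cayley-Hamilton polynomial *)

Lemma mul_delta_mx_delta (R : comNzRingType) (n : nat) (M : 'M[R]_n) a i j b :
  delta_mx a i *m M *m delta_mx j b = M i j *: delta_mx a b :> 'M_n.
Proof.
apply/matrixP => c d; rewrite !mxE (bigD1 j) //= [X in _ + X]big1 ?addr0.
  rewrite !mxE (bigD1 i) //= [X in _ + X]big1 ?addr0.
    by rewrite !mxE !eqxx /= andbT mulrAC -natrM mulnb mulrC.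
  by move=> l /negbTE Hl; rewrite !mxE Hl andbF mul0r.
by move=> l /negbTE Hl; rewrite !mxE Hl mulr0.
Qed.

Lemma natf_inj_pchar0 (F : fieldType) :
  [pchar F] =i pred0 -> injective (fun i : nat => i%:R : F).
Proof.
move=> /pcharf0P H i j /eqP Hij.
wlog le_ij : i j Hij / (i <= j)%N.
  by move=> W; case/orP: (leq_total i j) => /W -> //; rewrite eq_sym.
apply/eqP; rewrite eqn_leq le_ij /= -subn_eq0 -H natrB // subr_eq0 eq_sym //.
Qed.

Section CharCoef.
Variables (R : comNzRingType) (n : nat).

(* The coefficient of [a ^+ k] in [Qn] evaluated at [x_1 = ... = x_n = a], when
   [M] is the matrix whose powers give the traces. *)
Definition chc (M : 'M[R]_n) (k : nat) : R :=
  \sum_(s : 'S_n.+1 | #|porbit s ord_max|.-1 == k)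
     (-1) ^+ s * \prod_(i | cyc_leader s i) \tr (M ^+ #|porbit s i|).

(** Each cycle avoiding [ord_max] has exactly one leader, its least element. Mapping a point to the
    least element of its cycle partitions the complement of the cycle of [ord_max] into these
    cycles. *)
Lemma sum_card_leaders (s : 'S_n.+1) :
  (\sum_(i | cyc_leader s i) #|porbit s i| = n.+1 - #|porbit s ord_max|)%N.
Proof.
pose minrep j := [arg min_(i < j in porbit s j) (i : nat)].
have minrepP j : minrep j \in porbit s j /\
    forall i, i \in porbit s j -> (minrep j <= i)%N.
  by rewrite /minrep; case: arg_minnP => [|i Hi Hmin]; first exact: porbit_id.
have -> : (n.+1 - #|porbit s ord_max| = \sum_(j | j \notin porbit s ord_max) 1)%N.
  by rewrite sum1_card -{1}(card_ord n.+1) -(cardC (mem (porbit s ord_max))) addKn.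
have eqp i j : i \in porbit s j -> porbit s i = porbit s j.
  by move=> H; apply/eqP; rewrite eq_porbit_mem.
rewrite [RHS](partition_big minrep (cyc_leader s)) /=; last first.
  move=> j Hj; have [H1 H2] := minrepP j; rewrite /cyc_leader (eqp _ _ H1).
  rewrite porbit_sym Hj /=; apply/forall_inP => i; exact: H2.
apply: eq_bigr => i /andP[Hi /forall_inP Hmin]; rewrite -sum1_card.
apply: eq_bigl => j; apply/idP/andP => [Hj | [Hj /eqP <-]]; last first.
  by have [H _] := minrepP j; rewrite porbit_sym.
split; first by rewrite porbit_sym (eqp _ _ Hj).
have [H1 H2] := minrepP j; rewrite (eqp _ _ Hj) in H1 H2.
by apply/eqP/val_inj/eqP; rewrite eqn_leq H2 ?porbit_id //= Hmin.
Qed.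

Lemma card_porbit_le (s : 'S_n.+1) : (#|porbit s ord_max| <= n.+1)%N.
Proof. by rewrite -[X in (_ <= X)%N](card_ord n.+1) max_card. Qed.

Lemma card_porbit_gt0 (s : 'S_n.+1) i : (0 < #|porbit s i|)%N.
Proof. by apply/card_gt0P; exists i; apply: porbit_id. Qed.

Lemma scalemxX (g : R) (M : 'M[R]_n) k : (g *: M) ^+ k = g ^+ k *: M ^+ k.
Proof.
elim: k => [|k IH]; first by rewrite !expr0 scale1r.
by rewrite !exprS IH -[LHS]/(_ *m _) -scalemxAl -scalemxAr scalerA.
Qed.

(** The traces in a summand involve cycles of total length n+1 minus the k+1 points of the last
    cycle, so [chc] is homogeneous of degree n-k in the matrix. *)
Lemma chcZ (g : R) (M : 'M[R]_n) k :
  chc (g *: M) k = g ^+ (n - k) * chc M k.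
Proof.
rewrite /chc mulr_sumr; apply: eq_bigr => s /eqP Hs.
rewrite mulrCA; congr (_ * _).
under eq_bigr do rewrite scalemxX mxtraceZ.
rewrite big_split /= prodrXr sum_card_leaders.
by congr (g ^+ _ * _); rewrite -Hs -[in LHS](prednK (card_porbit_gt0 s ord_max)) subSS.
Qed.

Definition full_cycles := #|[set s : 'S_n.+1 | #|porbit s ord_max|.-1 == n]|.

(** For k = n the cycle of [ord_max] is everything: no trace factor remains, and the sign of an
    (n+1)-cycle is (-1)^n. *)
Lemma chc_lead (M : 'M[R]_n) : chc M n = (-1) ^+ n *+ full_cycles.
Proof.
rewrite /chc /full_cycles -sumr_const; apply: eq_big => [s|s].
  by rewrite inE.
rewrite ?inE => /eqP Hs.
have Hf : porbit s ord_max = [set: 'I_n.+1].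
  apply/eqP; rewrite eqEcard subsetT cardsT card_ord.
  by rewrite -(prednK (card_porbit_gt0 s ord_max)) Hs ltnSn.
rewrite big_pred0 ?mulr1; last first.
  by move=> i; rewrite /cyc_leader porbit_sym Hf inE.
have -> : odd_perm s = odd n.
  rewrite /odd_perm card_ord.
  have -> : porbits s = [set porbit s ord_max].
    apply/setP => B; rewrite inE; apply/imsetP/eqP => [[i _ ->]|->]; last by exists ord_max.
    by apply/eqP; rewrite eq_porbit_mem Hf inE.
  by rewrite cards1 /= addbT negbK.
by rewrite signr_odd.
Qed.

Lemma full_cycles_gt0 : (0 < full_cycles)%N.
Proof.
apply/card_gt0P; exists (perm (@ordS_inj n.+1)); rewrite inE.
set s := perm _.
suff -> : porbit s ord_max = [set: 'I_n.+1] by rewrite cardsT card_ord.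
(* The cyclic shift takes [ord_max], of value n, to j after j+1 steps, as n + j + 1 is j modulo
   n+1. *)
apply/setP => j; rewrite inE; apply/porbitP; exists j.+1.
rewrite permX; apply/val_inj.
have H k : val (iter k s ord_max) = ((n + k) %% n.+1)%N.
  elim: k => [|k IH] /=; first by rewrite addn0 modn_small.
  by rewrite permE /= IH -[X in (X %% _)%N = _]addn1 modnDml addn1 addnS.
by rewrite H addnS -addSn modnDl modn_small.
Qed.

End CharCoef.

Lemma chc_map (R S : comNzRingType) (f : {rmorphism R -> S}) n (M : 'M[R]_n) k :
  chc (map_mx f M) k = f (chc M k).
Proof.
rewrite /chc rmorph_sum; apply: eq_bigr => s _.
rewrite rmorphM rmorphXn rmorphN1 rmorph_prod; congr (_ * _).
apply: eq_bigr => i _; rewrite -trace_map_mx; congr (\tr _).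
elim: #|_| => [|m IH]; first by rewrite !expr0 map_mx1.
by rewrite !exprS -[RHS]/(map_mx f (_ *m _)) map_mxM IH.
Qed.

(** * The kernel of a trace-compatible evaluation *)

Section TraceRelation.
Variables (F : fieldType) (C : comNzRingType) (f : {rmorphism F -> C}).
Variables (A : nzRingType) (iota : {rmorphism C -> A}) (n : nat).
(** In the application, [Rel a M] says that some quasi-polynomial has class [a] in the quotient and
    value [M] at the generic matrices. As a relation, it does not presuppose that Phi factors
    through the quotient. *)
Variable Rel : A -> 'M[C]_n -> Prop.
Hypothesis pchar0 : [pchar F] =i pred0.
Hypothesis iotaC : forall c a, iota c * a = a * iota c.
Hypothesis RelD : forall a b M N, Rel a M -> Rel b N -> Rel (a + b) (M + N).
Hypothesis RelM : forall a b M N, Rel a M -> Rel b N -> Rel (a * b) (M *m N).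
Hypothesis RelC : forall c, Rel (iota c) c%:M.
Hypothesis RelCH : forall a M, Rel a M ->
  \sum_(k < n.+1) iota (chc M k) * a ^+ k = 0.

Lemma iota_f_regular u a : u != 0 -> iota (f u) * a = 0 -> a = 0.
Proof.
move=> Hu H; rewrite -[a]mul1r -(rmorph1 iota) -(rmorph1 f) -(mulVf Hu).
by rewrite !rmorphM -mulrA H mulr0.
Qed.

Lemma natf_neq0 m : (0 < m)%N -> m%:R != 0 :> F.
Proof. by move=> Hm; have /pcharf0P -> := pchar0; rewrite -lt0n. Qed.

Lemma RelZ c a M : Rel a M -> Rel (iota c * a) (c *: M).
Proof. by move=> /(RelM (RelC c)); rewrite mul_scalar_mx. Qed.

Lemma RelB a b M N : Rel a M -> Rel b N -> Rel (a - b) (M - N).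
Proof.
move=> Ha /(RelZ (-1)); rewrite rmorphN1 mulN1r scaleN1r; exact: RelD.
Qed.

Lemma Rel_sum (I : Type) (r : seq I) (a : I -> A) (M : I -> 'M[C]_n) :
  (forall i, Rel (a i) (M i)) -> Rel (\sum_(i <- r) a i) (\sum_(i <- r) M i).
Proof.
move=> H; elim/big_ind2: _ => //; last by move=> *; apply: RelD.
by have := RelC 0; rewrite rmorph0 (raddf0 (@scalar_mx C n)).
Qed.

Lemma RelX a M k : Rel a M -> Rel (a ^+ k) (M ^+ k).
Proof.
move=> H; elim: k => [|k IH]; last by rewrite !exprS; apply: RelM.
by rewrite !expr0 -(rmorph1 iota); apply: RelC.
Qed.

Lemma chc_lead_f (M : 'M[C]_n) : exists2 u : F, u != 0 & chc M n = f u.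
Proof.
exists ((-1) ^+ n *+ full_cycles n); last first.
  by rewrite chc_lead rmorphMn rmorphXn rmorphN1.
by rewrite -mulr_natr mulf_neq0 ?signr_eq0 // natf_neq0 ?full_cycles_gt0.
Qed.

(** Writing the zero matrix as 0 times itself, [chcZ] kills every coefficient below degree n; the
    one in degree n is a nonzero constant. *)
Lemma Rel0_nil x : Rel x 0 -> x ^+ n = 0.
Proof.
move=> /RelCH; rewrite big_ord_recr /= big1 ?add0r; last first.
  move=> k _; rewrite -(scaler0 _ 0) chcZ expr0n subn_eq0 leqNgt ltn_ord /=.
  by rewrite mul0r rmorph0 mul0r.
by have [u Hu ->] := chc_lead_f 0; apply: iota_f_regular.
Qed.

(** * Lifts of matrix units and of a diagonal matrix over a regular scalar *)

Section Regular.
(** In the application this is a power of the central value lying in the conductor, and [e] lifts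
    its multiples of the matrix units. *)
Variable g : C.
Hypothesis g_regular : forall a, iota g * a = 0 -> a = 0.

Lemma iota_regular k m a : k != 0 -> iota (g ^+ m * f k) * a = 0 -> a = 0.
Proof.
move=> Hk; elim: m => [|m IH]; first by rewrite expr0 mul1r; apply: iota_f_regular.
by rewrite exprS -mulrA rmorphM -mulrA => /g_regular.
Qed.

Lemma iotaX_regular k m j a :
  k != 0 -> iota (g ^+ m * f k) ^+ j * a = 0 -> a = 0.
Proof.
move=> Hk; elim: j => [|j IH]; first by rewrite expr0 mul1r.
by rewrite exprS -mulrA => /(iota_regular Hk).
Qed.

(* [u] differs from a regular scalar by a nilpotent element. *)
Lemma Rel_scalar_lreg u k m y :
  Rel u (g ^+ m * f k)%:M -> k != 0 -> u * y = 0 -> y = 0.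
Proof.
move=> Hu Hk Huy; set s := g ^+ m * f k in Hu.
have Hnil : (iota s - u) ^+ n = 0.
  by apply: Rel0_nil; rewrite -(subrr s%:M); apply: RelB.
(* As u kills y, each factor acts on y as the regular scalar s. *)
have H j : (iota s - u) ^+ j * y = iota s ^+ j * y.
  elim: j => [|j IH]; first by rewrite !expr0.
  rewrite exprS -mulrA IH mulrBl exprS -mulrA -rmorphXn (iotaC (s ^+ j)).
  by rewrite (mulrA u) Huy mul0r subr0.
by apply: (@iotaX_regular k m n) => //; rewrite -H Hnil mul0r.
Qed.

Lemma Rel_scalar_rreg u k m y :
  Rel u (g ^+ m * f k)%:M -> k != 0 -> y * u = 0 -> y = 0.
Proof.
move=> Hu Hk Hyu; set s := g ^+ m * f k in Hu.
have Hnil : (iota s - u) ^+ n = 0.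
  by apply: Rel0_nil; rewrite -(subrr s%:M); apply: RelB.
have H j : y * (iota s - u) ^+ j = iota s ^+ j * y.
  elim: j => [|j IH]; first by rewrite !expr0 mul1r mulr1.
  rewrite exprSr mulrA IH exprS -mulrA mulrBr Hyu subr0 -iotaC mulrA.
  by rewrite -!rmorphXn -rmorphM -exprSr exprS rmorphM.
by apply: (@iotaX_regular k m n) => //; rewrite -H Hnil mulr0.
Qed.

Variable e : 'I_n -> 'I_n -> A.
Hypothesis Rel_e : forall i j, Rel (e i j) (g *: delta_mx i j).

(** The sum over l of E_li M E_il is M_ii times the identity, so sandwiching isolates one diagonal
    entry as a scalar. *)
Lemma Rel_sandwich i X M :
  Rel X M -> Rel (\sum_l e l i * X * e i l) (g ^+ 2 * M i i)%:M.
Proof.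
move=> HX.
have -> : (g ^+ 2 * M i i)%:M =
    \sum_l (g *: delta_mx l i) *m M *m (g *: delta_mx i l) :> 'M[C]_n.
  under eq_bigr => l _.
    rewrite -!scalemxAl -!scalemxAr mul_delta_mx_delta scalerA scalerA -expr2.
    over.
  by rewrite -scaler_sumr [LHS]scalar_mx_sum_delta scaler_sumr.
by apply: Rel_sum => l; apply: RelM => //; apply: RelM.
Qed.

Variable i0 : 'I_n.
Hypothesis i0_val : val i0 = 0%N.

(** The same matrix diag(0, ..., n-1) over F and over C; its entries are distinct in characteristic
    0. Working over F makes [q k] a power of g times the constant [c k], which is regular once [c k]
    is nonzero. *)
Let DF : 'M[F]_n := diag_mx (\row_i (val i)%:R).
Let D : 'M[C]_n := diag_mx (\row_i (val i)%:R).
Let c k : F := chc DF k.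
Let q k : C := chc (g *: D) k.
Let h : A := \sum_i iota (val i)%:R * e i i.

Lemma lift_diag_qE k : q k = g ^+ (n - k) * f (c k).
Proof.
rewrite /q chcZ -chc_map /DF /D map_diag_mx; congr (_ * chc (diag_mx _) k).
by apply/rowP => i; rewrite !mxE rmorph_nat.
Qed.

Lemma lift_diag_Rel : Rel h (g *: D).
Proof.
have -> : g *: D = \sum_i (val i)%:R *: (g *: delta_mx i i).
  rewrite /D diag_mx_sum_delta scaler_sumr; apply: eq_bigr => i _.
  by rewrite mxE !scalerA mulrC.
by apply: Rel_sum => i; apply: RelZ.
Qed.

Lemma gD_exp k i : ((g *: D) ^+ k) i i = (g * (val i)%:R) ^+ k.
Proof.
have H j : (g *: D) ^+ j = diag_mx (\row_i (g * (val i)%:R) ^+ j).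
  elim: j => [|j IH].
    apply/matrixP => a b; rewrite !expr0 !mxE expr0.
    by rewrite mulrb; case: eqP.
  rewrite exprSr IH /D -[LHS]/(_ *m _) -scalemxAr mulmx_diag -linearZ; congr diag_mx.
  by apply/rowP => a; rewrite !mxE exprSr mulrCA.
by rewrite H !mxE eqxx.
Qed.

(** The element q(h) is 0 in A, yet it is related to q(gD), whose (i,i) entry is g^n times the value
    of the polynomial at i. Sandwiching shows that 0 is related to a regular scalar, so
    multiplication by 0 is injective. *)
Lemma poly_c_neq0_trivial (i : 'I_n) :
  (\poly_(k < n.+1) c k).[(val i)%:R] != 0 -> forall y : A, y = 0.
Proof.
move=> Hi y; set M := \sum_(k < n.+1) q k *: (g *: D) ^+ k.
have HQ : Rel (\sum_(k < n.+1) iota (q k) * h ^+ k) M.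
  by apply: Rel_sum => k; apply/RelZ/RelX/lift_diag_Rel.
have := Rel_sandwich i HQ.
have -> : g ^+ 2 * M i i = g ^+ (2 + n) * f (\poly_(k < n.+1) c k).[(val i)%:R].
  rewrite exprD -mulrA; congr (_ * _).
  rewrite horner_poly rmorph_sum mulr_sumr summxE; apply: eq_bigr => k _.
  rewrite mxE gD_exp lift_diag_qE rmorphM rmorphXn rmorph_nat exprMn.
  rewrite mulrACA -exprD subnK ?mulrA // -ltnS; exact: ltn_ord.
move/(@Rel_scalar_lreg _ _ _ y); apply => //.
rewrite big1 ?mul0r // => l _.
by rewrite (RelCH lift_diag_Rel) mulr0 mul0r.
Qed.

Hypothesis c_roots : forall i : 'I_n, (\poly_(k < n.+1) c k).[(val i)%:R] = 0.

Lemma lift_diag_c0 : c 0 = 0.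
Proof.
have := c_roots i0; rewrite i0_val horner_coef0 coef_poly /=; exact.
Qed.

(** As [c 0] vanishes, the polynomial is r X with r of degree below n. The roots make r vanish at 1,
    ..., n-1; if [c 1] = r(0) were 0, r would have n distinct roots and be zero, against its top
    coefficient [c n]. *)
Lemma lift_diag_c1 : c 1 != 0.
Proof.
have Hcn : c n != 0.
  rewrite /c chc_lead -mulr_natr mulf_neq0 ?signr_eq0 //.
  by rewrite natf_neq0 ?full_cycles_gt0.
have n_gt0 : (0 < n)%N := leq_ltn_trans (leq0n i0) (ltn_ord i0).
apply/eqP => Hc1; pose r : {poly F} := \poly_(k < n) c k.+1.
suff : r`_n.-1 = 0.
  by rewrite coef_poly prednK // leqnn; apply/eqP.
have Hpc : \poly_(k < n.+1) c k = r * 'X.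
  apply/polyP => -[|k]; rewrite coefMX !coef_poly //= lift_diag_c0 //.
suff -> : r = 0 by rewrite coef0.
apply: (@roots_geq_poly_eq0 _ _ [seq i%:R | i <- seq.iota 0 n]).
- apply/allP => x /mapP[i Hi ->] {x}; move: Hi; rewrite mem_iota add0n => /andP[_ Hi].
  case: i Hi => [|i] Hi; first by apply/rootP; rewrite horner_coef0 coef_poly n_gt0.
  have := c_roots (Ordinal Hi); rewrite Hpc hornerMX /= => /eqP.
  by rewrite mulf_eq0 (negbTE (natf_neq0 _)) // orbF.
- by rewrite map_inj_uniq ?iota_uniq //; apply: natf_inj_pchar0.
- by rewrite size_map size_iota size_poly.
Qed.

(** This is r(h) where q = X r. Since h E = 0, multiplying E by a polynomial in h keeps only the
    constant term of that polynomial. *)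
Let E : A := \sum_(k < n) iota (q k.+1) * h ^+ k.

Lemma lift_diag_q0 : q 0 = 0.
Proof. by rewrite lift_diag_qE lift_diag_c0 rmorph0 mulr0. Qed.

Lemma lift_diag_hE : h * E = 0.
Proof.
rewrite -[RHS](RelCH lift_diag_Rel) big_ord_recl -/(q 0) lift_diag_q0 rmorph0.
rewrite mul0r add0r /E mulr_sumr; apply: eq_bigr => k _.
by rewrite exprS !mulrA iotaC.
Qed.

Lemma lift_diag_q1_regular a : iota (q 1) * a = 0 -> a = 0.
Proof. by rewrite lift_diag_qE; apply/iota_regular/lift_diag_c1. Qed.

Lemma lift_diag_EE : E * E = iota (q 1) * E.
Proof.
rewrite {1}/E mulr_suml (bigD1 i0) //= i0_val expr0 mulr1 big1 ?addr0 // => k Hk.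
have : (k : nat) != 0%N by apply: contraNneq Hk => Hk; apply/eqP/val_inj; rewrite i0_val.
by case: (nat_of_ord k) => // j _; rewrite exprSr -!mulrA lift_diag_hE !mulr0.
Qed.

Lemma lift_diag_RelE : exists2 M : 'M[C]_n, Rel E M & M i0 i0 = g ^+ n.-1 * f (c 1).
Proof.
exists (\sum_(k < n) q k.+1 *: (g *: D) ^+ k).
  by apply: Rel_sum => k; apply/RelZ/RelX/lift_diag_Rel.
rewrite summxE (bigD1 i0) //= big1 ?addr0 => [|k Hk].
  by rewrite mxE gD_exp i0_val (_ : nat_of_ord i0 = 0%N) // expr0 mulr1 lift_diag_qE subn1.
rewrite mxE gD_exp i0_val mulr0 expr0n.
have /negbTE -> : (k : nat) != 0%N.
  by apply: contraNneq Hk => Hk; apply/eqP/val_inj; rewrite i0_val.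
by rewrite mulr0.
Qed.

(* [h + E p E] has the same characteristic polynomial as [h]. *)
Lemma lift_diag_EpE p : Rel p 0 -> E * p * E = 0.
Proof.
move=> Hp; set x := E * p * E.
have [ME HE _] := lift_diag_RelE.
have Hx : Rel x 0.
  by have := RelM (RelM HE Hp) HE; rewrite mulmx0 mul0mx.
have hx : h * x = 0 by rewrite /x !mulrA lift_diag_hE !mul0r.
have xE : x * E = iota (q 1) * x by rewrite /x -mulrA lift_diag_EE mulrA -iotaC -mulrA.
have hxX k : (h + x) ^+ k * x = x ^+ k.+1.
  elim: k => [|k IH]; first by rewrite expr0 mul1r.
  by rewrite exprS -mulrA IH mulrDl -exprS (exprS x k) mulrA hx mul0r add0r.
(* Multiply q(h + x) = 0 on the right by E. Since (h + x) E = x E = r(0) x, each power (h + x)^(k+1)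
   E becomes r(0) x^(k+1), and r(0) is regular. *)
have Hq : \sum_(k < n) iota (q k.+1) * x ^+ k.+1 = 0.
  apply: lift_diag_q1_regular.
  have := RelCH (RelD lift_diag_Rel Hx); rewrite addr0 big_ord_recl.
  rewrite -/(q 0) lift_diag_q0 rmorph0 mul0r add0r => /(congr1 (fun a => a * E)).
  rewrite mul0r mulr_suml => H; rewrite -[RHS]H mulr_sumr; apply: eq_bigr => k _.
  rewrite /bump /= -/(q k.+1) -mulrA (exprSr (h + x)) -(mulrA _ (h + x)) mulrDl lift_diag_hE add0r xE.
  by rewrite (mulrA _ (iota (q 1)) x) -(iotaC (q 1) (_ ^+ _)) -mulrA hxX !mulrA (iotaC (q 1)).
(* After multiplication of [Hq] by x^m, every term but the first contains x^(m+2), so only r(0)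
   x^(m+1) is left. *)
have Hdesc m : x ^+ m.+2 = 0 -> x ^+ m.+1 = 0.
  move=> Hm; apply: lift_diag_q1_regular.
  move/(congr1 (fun a => a * x ^+ m)): Hq; rewrite mul0r mulr_suml.
  rewrite (bigD1 i0) //= i0_val expr1 -mulrA -exprS big1 ?addr0 // => k Hk.
  have : (k : nat) != 0%N by apply: contraNneq Hk => Hk; apply/eqP/val_inj; rewrite i0_val.
  case: (nat_of_ord k) => // j _; rewrite -mulrA -exprD.
  by rewrite addnC -!addSnnS exprD Hm mul0r mulr0.
have: x ^+ n.+1 = 0 by rewrite exprS (Rel0_nil Hx) mulr0.
by elim: {1}n => [|m IH]; [rewrite expr1 | move/Hdesc].
Qed.

(** The sandwich u of E by the [e] is related to a regular scalar. First E p' u = 0, because each p'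
    [e l i0] still has generic value 0 and lies between two copies of E; hence E p' = 0. Then u p =
    0 for the same reason, and so p = 0. *)
Lemma lift_diag_kernel p : Rel p 0 -> p = 0.
Proof.
have [ME HE HME] := lift_diag_RelE.
have := Rel_sandwich i0 HE; rewrite HME mulrA -exprD => HU Hp.
have c1 := lift_diag_c1.
have EK p' : Rel p' 0 -> E * p' = 0.
  move=> Hp'; apply: (Rel_scalar_rreg HU c1).
  rewrite mulr_sumr big1 // => l _; rewrite !mulrA -(mulrA E).
  have := RelM Hp' (Rel_e l i0); rewrite mul0mx => /lift_diag_EpE ->.
  by rewrite mul0r.
apply: (Rel_scalar_lreg HU c1); rewrite mulr_suml big1 // => l _.
rewrite -!mulrA; have := RelM (Rel_e i0 l) Hp; rewrite mulmx0 => /EK ->.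
by rewrite mulr0.
Qed.

End Regular.

(** Whether 0, ..., n-1 are roots of the coefficient polynomial over F is decided by cases; this
    avoids identifying [chc] with the characteristic polynomial. *)
Lemma Rel_kernel_trivial (g : C) (e : 'I_n -> 'I_n -> A) p :
  (forall a, iota g * a = 0 -> a = 0) ->
  (forall i j, Rel (e i j) (g *: delta_mx i j)) -> (0 < n)%N ->
  Rel p 0 -> p = 0.
Proof.
move=> g_regular Rel_e n_gt0.
pose DF : 'M[F]_n := diag_mx (\row_i (val i)%:R).
case: (boolP [forall i : 'I_n, (\poly_(k < n.+1) chc DF k).[(val i)%:R] == 0]).
  move=> /forallP H; apply: (lift_diag_kernel g_regular Rel_e (i0 := Ordinal n_gt0)) => //.
  by move=> i; apply/eqP.
by case/forallPn => i /(poly_c_neq0_trivial g_regular Rel_e).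
Qed.

End TraceRelation.

(** * The conductor of a subalgebra of matrices *)

Section NilpotentTrace.
Variables (C : comNzRingType) (n : nat) (I : C -> Prop).
Hypothesis I0 : I 0.
Hypothesis ID : forall a b, I a -> I b -> I (a + b).
Hypothesis IM : forall a b, I b -> I (a * b).

Let upd (x : {ffun 'I_n.+1 -> 'I_n}) l a : {ffun 'I_n.+1 -> 'I_n} :=
  [ffun j => if j == l then a else x j].

(** Exchanging a with the l-th value of x is an involution on the pairs (x, a). It lets the index at
    l be summed separately, at the cost of a factor n. *)
Lemma sum_ffun_upd (G : {ffun 'I_n.+1 -> 'I_n} -> C) l :
  \sum_x \sum_a G (upd x l a) = n%:R * \sum_x G x.
Proof.
rewrite pair_bigA /=.
pose swp (p : {ffun 'I_n.+1 -> 'I_n} * 'I_n) := (upd p.1 l p.2, p.1 l).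
have swpK : involutive swp.
  move=> [x a]; rewrite /swp /=; congr pair; last by rewrite ffunE eqxx.
  by apply/ffunP => j; rewrite !ffunE; case: eqP => // ->.
rewrite (reindex_inj (inv_inj swpK)) /=.
under eq_bigr => p _.
  have -> : upd (upd p.1 l p.2) l (p.1 l) = p.1.
    by apply/ffunP => j; rewrite !ffunE; case: eqP => // ->.
  over.
rewrite -(pair_bigA _ (fun x _ => G x)) /= mulr_sumr; apply: eq_bigr => x _.
by rewrite sumr_const card_ord mulr_natl.
Qed.

Lemma I_sum (T : Type) (r : seq T) (P : pred T) (G : T -> C) :
  (forall i, P i -> I (G i)) -> I (\sum_(i <- r | P i) G i).
Proof. by move=> H; elim/big_ind: _. Qed.

Variable N : 'M[C]_n.
Hypothesis N2 : forall i j, I ((N *m N) i j).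

(** Choose l = s k different from k. The index x_l occurs only in N(x_k, x_l) and N(x_l, x_(s l)),
    so summing over it produces an entry of N^2. *)
Lemma I_perm_sum (s : 'S_n.+1) : s != 1%g ->
  I (n%:R * \sum_(x : {ffun 'I_n.+1 -> 'I_n}) \prod_k N (x k) (x (s k))).
Proof.
move=> s_neq1.
have [k Hk] : exists k, s k != k.
  apply/existsP; apply: contraR s_neq1 => /existsPn H.
  by apply/eqP/permP => k; rewrite perm1; have := H k; rewrite negbK => /eqP.
set l := s k in Hk.
have Hsl : s l != l by rewrite (inj_eq perm_inj).
rewrite -(sum_ffun_upd _ l); apply: I_sum => x _.
have -> : \sum_a \prod_j N (upd x l a j) (upd x l a (s j)) =
    (\prod_(j | (j != k) && (j != l)) N (x j) (x (s j))) * (N *m N) (x k) (x (s l)).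
  rewrite mxE mulr_sumr; apply: eq_bigr => a _.
  rewrite (bigD1 k) //= (bigD1 l) //= mulrA [LHS]mulrC; congr (_ * _).
    apply: eq_bigr => j /andP[Hjk Hjl]; rewrite !ffunE (negbTE Hjl).
    by rewrite (inj_eq perm_inj) (negbTE Hjk).
  by rewrite !ffunE -/l !eqxx (negbTE Hsl) [k == l]eq_sym (negbTE Hk).
by apply: IM.
Qed.

(* Every (n+1)-minor of [N] with repeated indices vanishes; modulo the entries
   of [N ^+ 2] only the identity permutation contributes to their sum. *)
Lemma I_trace_exp : I (n%:R * \tr N ^+ n.+1).
Proof.
have Hdet : \sum_(x : {ffun 'I_n.+1 -> 'I_n})
    \det (\matrix_(k, l) N (x k) (x l)) = 0.
  apply: big1 => x _.
  have /injectivePn[k [l Hkl Hx]] : ~~ injectiveb x.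
    apply/negP => /injectiveP /leq_card; rewrite !card_ord ltnn //.
  by rewrite -det_tr; apply: (determinant_alternate Hkl) => j; rewrite !mxE Hx.
move: Hdet; rewrite /determinant exchange_big /= (bigD1 (1%g : 'S_n.+1)) //=.
have -> : \sum_(x : {ffun 'I_n.+1 -> 'I_n}) (-1) ^+ (1%g : 'S_n.+1) *
    \prod_i (\matrix_(k, l) N (x k) (x l)) i ((1%g : 'S_n.+1) i) = \tr N ^+ n.+1.
  rewrite /mxtrace -[in RHS](card_ord n.+1) -prodr_const bigA_distr_bigA /=.
  apply: eq_bigr => x _; rewrite odd_perm1 expr0 mul1r; apply: eq_bigr => i _.
  by rewrite mxE perm1.
move/(congr1 (fun a => n%:R * a)); rewrite mulr0 mulrDr => /eqP.
rewrite addr_eq0 => /eqP ->; rewrite -mulrN -sumrN mulr_sumr; apply: I_sum => s Hs.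
rewrite -sumrN.
have -> : n%:R * \sum_(x : {ffun 'I_n.+1 -> 'I_n}) - ((-1) ^+ s *
   \prod_i (\matrix_(k, l) N (x k) (x l)) i (s i)) = - (-1) ^+ s *
   (n%:R * \sum_(x : {ffun 'I_n.+1 -> 'I_n}) \prod_k N (x k) (x (s k))).
  rewrite mulrCA; congr (_ * _); rewrite mulr_sumr; apply: eq_bigr => x _.
  by rewrite mulNr; congr (- (_ * _)); apply: eq_bigr => k _; rewrite mxE.
by apply/IM/I_perm_sum.
Qed.

End NilpotentTrace.

(** * Conductor elements from sums a_i z b_i that are always scalar *)

Section Conductor.
Variables (C : comNzRingType) (n : nat) (Rb : 'M[C]_n -> Prop).
Hypothesis RbD : forall M N, Rb M -> Rb N -> Rb (M + N).
Hypothesis RbM : forall M N, Rb M -> Rb N -> Rb (M *m N).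
Hypothesis RbC : forall c, Rb c%:M.

Definition conductor (c : C) : Prop := forall y, Rb (c *: y).

Lemma RbZ c M : Rb M -> Rb (c *: M).
Proof. by move=> HM; rewrite -mul_scalar_mx; apply: RbM. Qed.

Lemma Rb0 : Rb 0.
Proof. by have := RbC 0; rewrite raddf0. Qed.

Lemma Rb_sum (T : Type) (r : seq T) (G : T -> 'M[C]_n) :
  (forall i, Rb (G i)) -> Rb (\sum_(i <- r) G i).
Proof. by move=> H; elim/big_ind: _ => //; apply: Rb0. Qed.

Lemma conductor0 : conductor 0.
Proof. by move=> y; rewrite scale0r; apply: Rb0. Qed.

Lemma conductorD a b : conductor a -> conductor b -> conductor (a + b).
Proof. by move=> Ha Hb y; rewrite scalerDl; apply: RbD. Qed.

Lemma conductorM a b : conductor b -> conductor (a * b).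
Proof. by move=> Hb y; rewrite -scalerA; apply: RbZ. Qed.

(** In the application the pairs come from differentiating a central value in the coordinates of one
    generic matrix, and [lam a b] is its derivative in the coordinate (a, b). *)
Variables (s : seq ('M[C]_n * 'M[C]_n)) (lam : 'I_n -> 'I_n -> C).
Hypothesis s_Rb : forall p, p \in s -> Rb p.1 /\ Rb p.2.
Hypothesis s_lam : forall a b,
  \sum_(p <- s) p.1 *m delta_mx a b *m p.2 = (lam a b)%:M.

Let w := \sum_(p <- s) p.2 *m p.1.

Lemma s_lamE a b i j : \sum_(p <- s) p.1 i a * p.2 b j = lam a b *+ (i == j).
Proof.
move/matrixP/(_ i j): (s_lam a b); rewrite mxE => <-; rewrite summxE.
apply: eq_bigr => p _; rewrite !mxE (bigD1 b) //= big1 ?addr0.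
  rewrite !mxE (bigD1 a) //= big1 ?addr0; first by rewrite mxE !eqxx mulr1.
  by move=> c /negbTE Hc; rewrite mxE Hc mulr0.
move=> c /negbTE Hc; rewrite mxE big1 ?mul0r // => d _.
by rewrite mxE Hc andbF mulr0.
Qed.

Lemma wE a b : w b a = n%:R * lam a b.
Proof.
rewrite /w summxE.
under eq_bigr => p _ do rewrite mxE.
rewrite exchange_big /= -[n in n%:R]card_ord mulr_natl -sumr_const.
apply: eq_bigr => i _; have := s_lamE a b i i; rewrite eqxx mulr1n => <-.
by apply: eq_bigr => p _; rewrite mulrC.
Qed.

Lemma Rb_sum_s (G : 'M[C]_n * 'M[C]_n -> 'M[C]_n) :
  (forall p, p \in s -> Rb (G p)) -> Rb (\sum_(p <- s) G p).
Proof. by move=> H; rewrite big_seq; elim/big_ind: _ => //; apply: Rb0. Qed.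

(** By [s_lamE] and [wE], w y is n times the sum of tr(y a_i) b_i, a combination of the b_i with
    coefficients in C. The mirror lemma has tr(y b_i) a_i. *)
Lemma Rb_w_mul y : Rb (w *m y).
Proof.
have -> : w *m y = n%:R *: \sum_(p <- s) \tr (y *m p.1) *: p.2.
  apply/matrixP => i j; rewrite !mxE summxE.
  under [in RHS]eq_bigr => p _.
    rewrite mxE /mxtrace mulr_suml; under eq_bigr => a _.
      rewrite mxE mulr_suml; under eq_bigr => b _ do rewrite -mulrA.
      over.
    over.
  rewrite exchange_big mulr_sumr; apply: eq_bigr => a _ /=.
  rewrite wE -mulrA; congr (_ * _); rewrite exchange_big /= (bigD1 j) //=.
  rewrite -mulr_sumr s_lamE eqxx mulrC big1 ?addr0 // => b /negbTE Hb.
  by rewrite -mulr_sumr s_lamE Hb mulr0.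
by apply/RbZ/Rb_sum_s => p /s_Rb[_ H]; apply: RbZ.
Qed.

Lemma Rb_mul_w y : Rb (y *m w).
Proof.
have -> : y *m w = n%:R *: \sum_(p <- s) \tr (y *m p.2) *: p.1.
  apply/matrixP => i j; rewrite !mxE summxE.
  under [in RHS]eq_bigr => p _.
    rewrite mxE /mxtrace mulr_suml; under eq_bigr => a _.
      rewrite mxE mulr_suml; under eq_bigr => b _ do rewrite -mulrA (mulrC (p.2 _ _)).
      over.
    over.
  rewrite exchange_big [in RHS](bigD1 i) //= [X in _ + X]big1 ?addr0; last first.
    move=> a /negbTE Ha; rewrite /= exchange_big big1 // => b _.
    by rewrite -mulr_sumr s_lamE eq_sym Ha mulr0.
  rewrite exchange_big mulr_sumr; apply: eq_bigr => a _ /=.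
  by rewrite wE -mulr_sumr s_lamE eqxx mulrCA.
by apply/RbZ/Rb_sum_s => p /s_Rb[H _]; apply: RbZ.
Qed.

(** An entry times E_ab is E_ai (w z w) E_jb, and grouping it as (E_ai w) z (w E_jb) puts all three
    factors in [Rb]. *)
Lemma conductor_wzw z i j : Rb z -> conductor ((w *m z *m w) i j).
Proof.
move=> Hz y.
have -> : (w *m z *m w) i j *: y =
    \sum_a \sum_b y a b *: ((delta_mx a i *m w) *m z *m (w *m delta_mx j b)).
  rewrite {1}(matrix_sum_delta y) scaler_sumr; apply: eq_bigr => a _.
  rewrite scaler_sumr; apply: eq_bigr => b _; rewrite !scalerA mulrC -scalerA.
  by congr (_ *: _); rewrite -mul_delta_mx_delta !mulmxA.
apply: Rb_sum => a; apply: Rb_sum => b; apply: RbZ.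
by apply: RbM; [apply: RbM => //; apply: Rb_mul_w | apply: Rb_w_mul].
Qed.

(** This is [I_trace_exp] for N = w z: the square (w z w) z has entries in the conductor, and the
    expression raised to the power n+1 is tr(w z). *)
Lemma conductor_trace z : Rb z ->
  conductor (n%:R * (n%:R * \sum_a \sum_b lam a b * z a b) ^+ n.+1).
Proof.
move=> Hz.
have -> : n%:R * \sum_a \sum_b lam a b * z a b = \tr (w *m z).
  rewrite /mxtrace mulr_sumr.
  under [in RHS]eq_bigr => b _ do rewrite mxE.
  rewrite [RHS]exchange_big; apply: eq_bigr => a _ /=.
  rewrite mulr_sumr; apply: eq_bigr => b _.
  by rewrite wE mulrA.
apply: (I_trace_exp conductor0 conductorD conductorM) => i j.
rewrite mulmxA mxE; elim/big_ind: _ => [||k _].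
- exact: conductor0.
- exact: conductorD.
- by rewrite mulrC; apply/conductorM/conductor_wzw.
Qed.

End Conductor.

(** * Multivariate polynomials *)

Lemma digits_inj (D N : nat) (a b : nat -> nat) :
  (forall i, a i < D)%N -> (forall i, b i < D)%N ->
  (\sum_(i < N) a i * D ^ i = \sum_(i < N) b i * D ^ i)%N ->
  forall i, (i < N)%N -> a i = b i.
Proof.
elim: N a b => [//|N IH] a b Ha Hb.
have D_gt0 : (0 < D)%N := leq_ltn_trans (leq0n _) (Ha 0%N).
have split (x : nat -> nat) : (\sum_(i < N.+1) x i * D ^ i =
    x 0 + (\sum_(i < N) x i.+1 * D ^ i) * D)%N.
  rewrite big_ord_recl /= expn0 muln1 big_distrl /=; congr (_ + _)%N.
  by apply: eq_bigr => i _; rewrite /bump /= expnSr mulnA.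
rewrite !split => H.
have H0 : a 0%N = b 0%N.
  by move/(congr1 (modn^~ D)): (H); rewrite ![(_ + _ * D)%N]addnC !modnMDl !modn_small.
have HS : (\sum_(i < N) a i.+1 * D ^ i = \sum_(i < N) b i.+1 * D ^ i)%N.
  by move/eqP: H; rewrite H0 eqn_add2l eqn_pmul2r // => /eqP.
case=> [//|i] Hi; exact: (IH (fun i => a i.+1) (fun i => b i.+1)).
Qed.

(* Kronecker substitution [X_i := X ^ (D ^ i)] with [D] above the degree of [p]. *)
Lemma mpoly_eval_eq0 (F : fieldType) (N : nat) (p : {mpoly F[N]}) :
  [pchar F] =i pred0 -> (forall v, p.@[v] = 0) -> p = 0.
Proof.
move=> pchar0 Hp; apply/eqP; apply: contraT => p_neq0.
pose D := msize p; pose kr (m : 'X_{1..N}) := (\sum_(i < N) m i * D ^ i)%N.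
pose u : {poly F} := \sum_(m <- msupp p) p@_m *: 'X^(kr m).
have u0 : u = 0.
  apply: (@roots_geq_poly_eq0 _ _ [seq i%:R | i <- iota 0 (size u)]).
  - apply/allP => x /mapP[t _ ->]; apply/rootP.
    rewrite -[RHS](Hp (fun i => t%:R ^+ (D ^ i))) mevalE /u horner_sum.
    apply: eq_bigr => m _; rewrite hornerZ hornerXn; congr (_ * _).
    by rewrite -prodrXr; apply: eq_bigr => i _; rewrite -exprM mulnC.
  - by rewrite map_inj_uniq ?iota_uniq //; apply: natf_inj_pchar0.
  - by rewrite size_map size_iota.
have kr_inj m m' : m \in msupp p -> m' \in msupp p -> kr m = kr m' -> m = m'.
  have lt_D m1 (i : 'I_N) : m1 \in msupp p -> (m1 i < D)%N.
    move/msize_mdeg_lt; apply: leq_ltn_trans.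
    by rewrite mdegE (bigD1 i) //= leq_addr.
  have D_gt0 : (0 < D)%N by rewrite lt0n msize_poly_eq0.
  move=> Hm Hm' Hk; apply/mnmP => i.
  (* Exponents are extended by 0 beyond N, since [digits_inj] takes digits indexed by all
     naturals. *)
  pose a (m1 : 'X_{1..N}) (j : nat) := if insub j is Some j' then m1 j' else 0%N.
  have aE m1 (j : 'I_N) : a m1 j = m1 j by rewrite /a valK.
  have aD m1 j : m1 \in msupp p -> (a m1 j < D)%N.
    by move=> Hm1; rewrite /a; case: insubP => // j' _ _; apply: lt_D.
  have krE m1 : kr m1 = (\sum_(j < N) a m1 j * D ^ j)%N.
    by apply: eq_bigr => j _; rewrite aE.
  rewrite -(aE m) -(aE m'); apply: (@digits_inj D N (a m) (a m')) => //.
  - by move=> j; apply: aD.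
  - by move=> j; apply: aD.
  - by rewrite -!krE.
have := mlead_supp p_neq0; rewrite mcoeff_msupp => /eqP[].
have := congr1 (fun v : {poly F} => v`_(kr (mlead p))) u0.
rewrite coef0 /u coef_sum (bigD1_seq (mlead p)) ?mlead_supp ?msupp_uniq //=.
rewrite big_seq_cond big1 ?addr0; first by rewrite coefZ coefXn eqxx mulr1.
move=> m /andP[Hm Hne]; rewrite coefZ coefXn.
case: eqP => [/esym H|_]; last by rewrite mulr0.
by rewrite (kr_inj _ _ _ _ H) ?mlead_supp // eqxx in Hne.
Qed.

(** By bilinearity both factors may be taken to be monomials; then only the term with e the degree
    of the first one survives, if there is one. *)
Lemma pihomogM (R : comNzRingType) (N d : nat) (p q : {mpoly R[N]}) :
  pihomog mdeg d (p * q) =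
  \sum_(e < d.+1) pihomog mdeg e p * pihomog mdeg (d - e) q.
Proof.
elim/mpolyind: p => [|c m p _ _ IHp].
  by rewrite mul0r pihomog0 big1 // => e _; rewrite pihomog0 mul0r.
rewrite mulrDl pihomogD IHp.
under [in RHS]eq_bigr do rewrite pihomogD mulrDl.
rewrite big_split /=; congr (_ + _) => {IHp p}.
rewrite -scalerAl linearZ /=.
under eq_bigr do rewrite linearZ /= -scalerAl.
rewrite -scaler_sumr; congr (_ *: _).
elim/mpolyind: q => [|c' m' q _ _ IHq].
  by rewrite mulr0 pihomog0 big1 // => e _; rewrite pihomog0 mulr0.
rewrite mulrDr pihomogD IHq.
under [in RHS]eq_bigr do rewrite pihomogD mulrDr.
rewrite big_split /=; congr (_ + _) => {IHq q}.
rewrite -scalerAr linearZ /=.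
under eq_bigr do rewrite linearZ /= -scalerAr.
rewrite -scaler_sumr; congr (_ *: _).
rewrite -mpolyXD pihomogX /= mdegD.
case: (leqP (mdeg m) d) => Hm.
  rewrite (bigD1 (Ordinal (Hm : mdeg m < d.+1)%N)) //= big1 ?addr0.
    rewrite !pihomogX /= eqxx -[X in _ * (if X then _ else _)](eqn_add2l (mdeg m)) subnKC //.
    by case: ifP; rewrite ?mulr0 ?mpolyXD.
  by move=> e He; rewrite pihomogX eq_sym -(inj_eq val_inj) /= in He *; rewrite (negbTE He) mul0r.
rewrite gtn_eqF ?big1 //; last exact: ltn_addr.
move=> e _; rewrite pihomogX gtn_eqF ?mul0r //.
by apply: leq_ltn_trans Hm; rewrite -ltnS.
Qed.

Lemma euler_homog (R : comNzRingType) (N d : nat) (p : {mpoly R[N]}) :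
  p \is d.-homog -> \sum_i 'X_i * p^`M(i) = p *+ d.
Proof.
move=> /dhomogP Hp; rewrite [in RHS](mpolyE p) -sumrMnl.
under eq_bigr do rewrite /mderiv mulr_sumr.
rewrite exchange_big big_seq [RHS]big_seq; apply: eq_bigr => m Hm /=.
rewrite -(Hp _ Hm) /= mdegE -sumrMnr; apply: eq_bigr => i _.
rewrite -scalerAr -mpolyXD -scalerA scaler_nat.
(* If m i = 0, the truncated exponent is harmless because its coefficient is 0. *)
case: (posnP (m i)) => [->|Hmi]; first by rewrite !mulr0n.
by rewrite addmC submK // lep1mP -lt0n.
Qed.

(** * Generic matrices *)

Section GenericMatrices.
Variables (F : fieldType) (n K : nat).
Local Notation qp := (quasipoly F n).
Local Notation idx := ('I_K * 'I_n * 'I_n)%type.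
Local Notation C := {mpoly F[#|{: idx}|]}.

(* The coordinates of x_k; those with [K <= k] are sent to 0. *)
Definition gvar (k : nat) (i j : 'I_n) : C :=
  if insub k is Some k' then 'X_(enum_rank (k' : 'I_K, i, j)) else 0.

(** This is [Phi] with values in matrices over a genuine polynomial ring; [qpi_Phi] links the two.
    The bound [K] is there because [mpoly] has finitely many variables. *)
Fixpoint gmat (p : qp) : 'M[C]_n :=
  match p with
  | QConst a => (a%:MP)%:M
  | QCVar k a b => (gvar k a b)%:M
  | QVar k => \matrix_(i, j) gvar k i j
  | QAdd p q => gmat p + gmat q
  | QMul p q => gmat p *m gmat q
  | QOpp p => - gmat p
  end.

Fixpoint vars_below (p : qp) : bool :=
  match p with
  | QConst _ => true
  | QCVar k _ _ | QVar k => (k < K)%N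
  | QAdd p q | QMul p q => vars_below p && vars_below q
  | QOpp p => vars_below p
  end.

Definition in_gmat (M : 'M[C]_n) : Prop := exists2 p, vars_below p & gmat p = M.

Lemma gvar_ord (k : 'I_K) i j : gvar k i j = 'X_(enum_rank (k, i, j)).
Proof. by rewrite /gvar valK. Qed.

Lemma meval_gmat v p :
  map_mx (meval v) (gmat p) = qeval (fun k => \matrix_(i, j) (gvar k i j).@[v]) p.
Proof.
elim: p => [a|k a b|k|p IHp q IHq|p IHp q IHq|p IHp] /=.
- by rewrite map_scalar_mx /= mevalC.
- by rewrite map_scalar_mx /= mxE.
- by apply/matrixP => i j; rewrite !mxE.
- by rewrite map_mxD IHp IHq.
- by rewrite map_mxM IHp IHq.
- by rewrite map_mxN IHp.
Qed.

Hypothesis pchar0 : [pchar F] =i pred0.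

Lemma gmat_quasi_identity P : quasi_identity P -> gmat P = 0.
Proof.
move=> HP; apply/matrixP => i j; rewrite mxE; apply: mpoly_eval_eq0 => // v.
have := meval_gmat v P; rewrite HP => /matrixP/(_ i j); rewrite !mxE; exact.
Qed.

Lemma gmat_central c i0 : central_poly c -> gmat c = (gmat c i0 i0)%:M.
Proof.
move=> [_ Hc]; apply/matrixP => i j; apply/eqP; rewrite -subr_eq0; apply/eqP.
apply: mpoly_eval_eq0 => // v; have [a Ha] := Hc (fun k => \matrix_(i, j) (gvar k i j).@[v]).
have E a' b' : (gmat c a' b').@[v] = a *+ (a' == b').
  by have := meval_gmat v c; rewrite Ha => /matrixP/(_ a' b'); rewrite !mxE.
by rewrite mevalB mxE mevalMn !E eqxx subrr.
Qed.

Lemma in_gmatD M N : in_gmat M -> in_gmat N -> in_gmat (M + N).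
Proof.
by move=> [p Hp <-] [q Hq <-]; exists (QAdd p q) => //=; rewrite Hp Hq.
Qed.

Lemma in_gmatM M N : in_gmat M -> in_gmat N -> in_gmat (M *m N).
Proof.
by move=> [p Hp <-] [q Hq <-]; exists (QMul p q) => //=; rewrite Hp Hq.
Qed.

Lemma in_gmatC c : in_gmat c%:M.
Proof.
have HX m : in_gmat ('X_[m])%:M.
  rewrite [X in X%:M]mpolyXE_id; elim/big_ind: _ => [||i _].
  - by exists (QConst 1).
  - by move=> a b Ha Hb; rewrite scalar_mxM; apply: in_gmatM.
  elim: (m i) => [|k IH]; first by exists (QConst 1).
  rewrite exprS scalar_mxM; apply: in_gmatM => //.
  case E: (enum_val i) => [[l a] b]; exists (QCVar l a b) => //=.
  by rewrite gvar_ord -E enum_valK.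
elim/mpolyind: c => [|a m p _ _ IH]; first by exists (QConst 0); rewrite //= mpolyC0.
rewrite raddfD /=; apply: in_gmatD => //.
rewrite -mul_mpolyC scalar_mxM; apply: in_gmatM => //.
by exists (QConst a).
Qed.

Lemma in_gmatN M : in_gmat M -> in_gmat (- M).
Proof. by move=> [p Hp <-]; exists (QOpp p). Qed.

(** Leibniz rule: an occurrence of x_k in u x_k v contributes u E_ab v. One list of pairs (u, v)
    serves all coordinates (a, b). *)
Lemma gmat_deriv (k : 'I_K) p : in_free_alg p -> vars_below p ->
  exists2 s : seq ('M[C]_n * 'M[C]_n),
    forall x, x \in s -> in_gmat x.1 /\ in_gmat x.2 &
    forall a b, map_mx (mderiv (enum_rank (k, a, b))) (gmat p) =
      \sum_(x <- s) x.1 *m delta_mx a b *m x.2.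
Proof.
elim: p => [a||k'|p IHp q IHq|p IHp q IHq|p IHp] //=.
- move=> _ _; exists [::] => // a' b'; rewrite big_nil; apply/matrixP => i j.
  by rewrite !mxE; case: eqP => _; rewrite ?mulr1n ?mulr0n ?mderivC ?mderiv0.
- move=> _ Hk'; case: (eqVneq k' k) => [->|neq].
    exists [:: (1%:M, 1%:M)].
      by move=> x; rewrite inE => /eqP ->; split; apply: in_gmatC.
    move=> a b; rewrite big_seq1 mul1mx mulmx1; apply/matrixP => i j.
    rewrite !mxE gvar_ord mderivX mnm1E (inj_eq enum_rank_inj) !xpair_eqE eqxx /=.
    case: (boolP ((i == a) && (j == b))) => [/andP[/eqP -> /eqP ->]|_].
      by rewrite scale1r -[X in (X - _)%MM]add0m addmK mpolyX0.
    by rewrite scale0r.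
  exists [::] => // a b; rewrite big_nil; apply/matrixP => i j.
  rewrite !mxE -[k']/(val (Ordinal Hk')) gvar_ord mderivX mnm1E (inj_eq enum_rank_inj).
  by rewrite !xpair_eqE -val_eqE /= (negbTE neq) scale0r.
- move=> /andP[/IHp{}IHp /IHq{}IHq] /andP[/IHp[s Hs1 Hs2] /IHq[t Ht1 Ht2]].
  exists (s ++ t).
    by move=> x; rewrite mem_cat => /orP[/Hs1|/Ht1].
  by move=> a b; rewrite big_cat -Hs2 -Ht2; apply/matrixP => i j; rewrite !mxE mderivD.
- move=> /andP[/IHp{}IHp /IHq{}IHq] /andP[Hp Hq].
  have [s Hs1 Hs2] := IHp Hp; have [t Ht1 Ht2] := IHq Hq.
  have Rp : in_gmat (gmat p) by exists p.
  have Rq : in_gmat (gmat q) by exists q.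
  exists ([seq (x.1, x.2 *m gmat q) | x <- s] ++ [seq (gmat p *m x.1, x.2) | x <- t]).
    move=> x; rewrite mem_cat => /orP[] /mapP[y].
      by move=> /Hs1[H1 H2] ->; split=> //=; apply: in_gmatM.
    by move=> /Ht1[H1 H2] ->; split=> //=; apply: in_gmatM.
  move=> a b; rewrite big_cat !big_map /=.
  under eq_bigr do rewrite mulmxA.
  under [X in _ + X]eq_bigr do rewrite -2!mulmxA.
  rewrite -mulmx_suml -Hs2 -mulmx_sumr.
  under [X in _ + _ *m X]eq_bigr do rewrite mulmxA.
  rewrite -Ht2; apply/matrixP => i j; rewrite !mxE (big_morph _ (mderivD _) (mderiv0 _ _)).
  by rewrite -big_split; apply: eq_bigr => l _; rewrite !mxE mderivM.
- move=> /IHp{}IHp /IHp[s Hs1 Hs2].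
  exists [seq (- x.1, x.2) | x <- s].
    by move=> x /mapP[y /Hs1[H1 H2] ->]; split=> //=; apply: in_gmatN.
  move=> a b; rewrite big_map /=.
  under eq_bigr do rewrite !mulNmx.
  by rewrite sumrN -Hs2; apply/matrixP => i j; rewrite !mxE mderivN.
Qed.

(** * Homogeneous components of elements of the free algebra *)

Fixpoint hcomp (d : nat) (p : qp) : qp :=
  match p with
  | QConst a => if d == 0%N then QConst a else QConst 0
  | QCVar _ _ _ => QConst 0
  | QVar k => if d == 1%N then QVar k else QConst 0
  | QAdd p q => QAdd (hcomp d p) (hcomp d q)
  | QMul p q => qsum [seq QMul (hcomp e p) (hcomp (d - e) q) | e <- iota 0 d.+1]
  | QOpp p => QOpp (hcomp d p)
  end.

Lemma gmat_qsum s : gmat (qsum s) = \sum_(p <- s) gmat p.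
Proof.
elim: s => [|p s IH] /=; first by rewrite big_nil mpolyC0 raddf0.
by rewrite big_cons IH.
Qed.

Lemma vars_below_qsum s : vars_below (qsum s) = all vars_below s.
Proof. by elim: s => //= p s ->. Qed.

Lemma in_free_alg_qsum (s : seq qp) : in_free_alg (qsum s) = all (@in_free_alg F n) s.
Proof. by elim: s => //= p s ->. Qed.

Lemma hcompM d (p q : qp) : hcomp d (QMul p q) =
  qsum [seq QMul (hcomp e p) (hcomp (d - e) q) | e <- iota 0 d.+1].
Proof. by []. Qed.

Lemma vars_below_hcomp d p : vars_below p -> vars_below (hcomp d p).
Proof.
elim: p d => [a|//|k|p IHp q IHq|p IHp q IHq|p IHp] d.
- by rewrite /=; case: eqP.
- by rewrite /=; case: eqP.
- by move=> /= /andP[/IHp -> /IHq ->].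
- move=> /andP[Hp Hq]; rewrite hcompM.
  by rewrite vars_below_qsum; apply/allP => x /mapP[e _ ->]; rewrite /= IHp // IHq.
- exact: IHp.
Qed.

Lemma in_free_alg_hcomp d p : in_free_alg p -> in_free_alg (hcomp d p).
Proof.
elim: p d => [a|//|k|p IHp q IHq|p IHp q IHq|p IHp] d.
- by rewrite /=; case: eqP.
- by rewrite /=; case: eqP.
- by move=> /= /andP[/IHp -> /IHq ->].
- move=> /andP[Hp Hq]; rewrite hcompM.
  by rewrite in_free_alg_qsum; apply/allP => x /mapP[e _ ->]; rewrite /= IHp // IHq.
- exact: IHp.
Qed.

(** In the free algebra x_k has degree 1, as do its generic entries, so both gradings agree. The
    value of [hcomp] at [QCVar] is a placeholder excluded by [in_free_alg]. *)
Lemma gmat_hcomp d p i j : in_free_alg p ->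
  gmat (hcomp d p) i j = pihomog mdeg d (gmat p i j).
Proof.
elim: p d i j => [a|//|k|p IHp q IHq|p IHp q IHq|p IHp] d i j.
- move=> _; have Ha : (a%:MP : C) \is 0.-homog.
    by rewrite -[a%:MP]mulr1 mul_mpolyC; apply/rpredZ/dhomog1.
  have -> : gmat (hcomp d (QConst a)) i j = (if d == 0%N then a%:MP else 0) *+ (i == j).
    by rewrite /=; case: eqP => _; rewrite mxE ?mpolyC0.
  rewrite /= mxE pihomogMn; congr (_ *+ _).
  case: (eqVneq d 0%N) => [->|Hd]; first by rewrite pihomog_dE.
  by rewrite (pihomog_ne0 _ Ha) // eq_sym.
- move=> _.
  have -> : gmat (hcomp d (QVar k)) i j = (if d == 1%N then gvar k i j else 0).
    by rewrite /=; case: eqP => _; rewrite mxE ?mpolyC0 ?mul0rn.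
  rewrite /= mxE /gvar; case: insubP => [k' _ _|_]; last by rewrite pihomog0 if_same.
  by rewrite pihomogX /= mdeg1 eq_sym.
- by move=> /= /andP[Hp Hq]; rewrite !mxE IHp // IHq // pihomogD.
- move=> /andP[Hp Hq]; rewrite hcompM gmat_qsum big_map summxE.
  rewrite mxE (big_morph _ (pihomogD _ _) (pihomog0 _ _ _)).
  under [in RHS]eq_bigr do rewrite pihomogM.
  rewrite exchange_big -[iota 0 d.+1]/(index_iota 0 d.+1) big_mkord.
  apply: eq_bigr => e _ /=; rewrite mxE; apply: eq_bigr => l _.
  by rewrite IHp // IHq.
- by move=> /= Hp; rewrite !mxE IHp // pihomogN.
Qed.

Lemma gmat_hcomp0 p : in_free_alg p -> gmat (hcomp 0 p) = (const_term p)%:MP%:M.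
Proof.
elim: p => [a|//|k|p IHp q IHq|p IHp q IHq|p IHp] //=.
- by move=> /andP[/IHp -> /IHq ->]; rewrite mpolyCD raddfD.
- move=> /andP[/IHp -> /IHq ->].
  by rewrite mpolyC0 raddf0 addr0 -scalar_mxM mpolyCM.
- by move=> /IHp ->; rewrite mpolyCN raddfN.
Qed.

(** * The radical of the conductor *)

Local Notation cond := (conductor in_gmat).

Lemma rad_conductorD a b :
  (exists m, cond (a ^+ m)) -> (exists m, cond (b ^+ m)) ->
  exists m, cond ((a + b) ^+ m).
Proof.
move=> [m1 H1] [m2 H2]; exists (m1 + m2)%N; rewrite exprDn.
elim/big_ind: _ => [||i _].
- exact: conductor0 in_gmatC.
- exact: conductorD in_gmatD.
rewrite -mulr_natl; apply: (conductorM in_gmatM in_gmatC).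
case: (leqP m2 i) => Hi.
  rewrite -(subnK Hi) exprD mulrA; exact: (conductorM in_gmatM in_gmatC).
have Hm : (m1 <= m1 + m2 - i)%N by rewrite -addnBA ?leq_addr // ltnW.
rewrite -(subnK Hm) exprD mulrC mulrA; exact: (conductorM in_gmatM in_gmatC).
Qed.

Lemma rad_conductor_sum (T : Type) (r : seq T) (P : pred T) (G : T -> C) :
  (forall i, P i -> exists m, cond (G i ^+ m)) ->
  exists m, cond ((\sum_(i <- r | P i) G i) ^+ m).
Proof.
move=> H; elim/big_ind: _ => //; last exact: rad_conductorD.
by exists 1%N; rewrite expr1; apply: conductor0 in_gmatC.
Qed.

Lemma natC_unit m a : (0 < m)%N -> cond (m%:R * a) -> cond a.
Proof.
move=> Hm /(conductorM in_gmatM in_gmatC (m%:R^-1)%:MP).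
rewrite mulrA -mpolyC_nat -mpolyCM mulVf ?mpolyC1 ?mul1r //.
by have /pcharf0P -> := pchar0; rewrite -lt0n.
Qed.

Hypothesis n_gt0 : (0 < n)%N.

(** For each k, [conductor_trace] with z the k-th generic matrix gives an element of the radical;
    their sum is n d g by Euler's formula, and n d is invertible. *)
Lemma rad_conductor_homog p g d : in_free_alg p -> vars_below p -> (0 < d)%N ->
  gmat p = g%:M -> g \is d.-homog -> exists m, cond (g ^+ m).
Proof.
move=> Hfree Hvars d_gt0 Hg Hhom.
have Hk (k : 'I_K) : exists m, cond
    ((n%:R * \sum_a \sum_b g^`M(enum_rank (k, a, b)) * gvar k a b) ^+ m).
  exists n.+1; apply: (natC_unit n_gt0).
  have [s Hs1 Hs2] := gmat_deriv k Hfree Hvars.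
  have Hz : in_gmat (\matrix_(i, j) gvar k i j) by exists (QVar k) => //=.
  under eq_bigr => a _ do under eq_bigr => b _ do
    rewrite -[gvar k a b](mxE matrix_key (fun i j => gvar k i j)).
  apply: (conductor_trace in_gmatD in_gmatM in_gmatC Hs1 _ Hz) => a b.
  by rewrite -Hs2 Hg; apply/matrixP => i j; rewrite !mxE mderivMn.
have [m Hm] := rad_conductor_sum (index_enum 'I_K) (P := xpredT) (fun k _ => Hk k).
exists m; move: Hm.
have -> : \sum_k n%:R * (\sum_a \sum_b g^`M(enum_rank (k, a, b)) * gvar k a b)
    = (n * d)%:R * g.
  rewrite -mulr_sumr natrM -mulrA; congr (_ * _).
  rewrite mulr_natl -(euler_homog Hhom) (reindex (@enum_rank idx)) /=; last first.
    by apply: onW_bij; apply: enum_rank_bij.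
  rewrite pair_bigA pair_bigA /=; apply: eq_bigr => -[[k a] b] _.
  by rewrite gvar_ord mulrC.
rewrite exprMn -natrX; apply: natC_unit.
by rewrite expn_gt0 muln_gt0 n_gt0 d_gt0.
Qed.

(** Each homogeneous component of g is the generic value of a component of c. The vanishing constant
    term disposes of degree 0, where Euler's formula says nothing. *)
Lemma rad_conductor_central c i0 : central_poly c -> const_term c = 0 ->
  vars_below c -> exists m, cond (gmat c i0 i0 ^+ m).
Proof.
move=> Hc Hc0 Hvars; have [Hfree _] := Hc; set g := gmat c i0 i0.
have Hg : gmat c = g%:M := gmat_central i0 Hc.
have Hd d : gmat (hcomp d c) = (pihomog mdeg d g)%:M.
  by apply/matrixP => i j; rewrite gmat_hcomp // Hg !mxE pihomogMn.
rewrite (pihomog_partitionE (leqnn (mmeasure mdeg g))).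
apply: rad_conductor_sum => d _; case: (posnP d) => [->|d_gt0].
  exists 1%N; rewrite expr1.
  have := Hd 0%N; rewrite gmat_hcomp0 // Hc0 mpolyC0 => /matrixP/(_ i0 i0).
  by rewrite !mxE eqxx !mulr1n => <-; apply: conductor0 in_gmatC.
apply: (rad_conductor_homog (in_free_alg_hcomp d Hfree) (vars_below_hcomp d Hvars) d_gt0 (Hd d)).
exact: pihomogP.
Qed.

End GenericMatrices.

(** * Quasi-polynomials modulo the Cayley-Hamilton identity *)

Section ScalarMorphism.
Variables (F : fieldType) (n K : nat) (I : qideal F n).
Local Notation qp := (quasipoly F n).
Local Notation idx := ('I_K * 'I_n * 'I_n)%type.
Local Notation C := {mpoly F[#|{: idx}|]}.
Local Notation gmat := (@gmat F n K).
Local Notation vars_below := (@vars_below F n K).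

Definition qconst (a : F) : qquot I := qpi I (QConst a).

Lemma qconst_is_zmod_morphism : zmod_morphism qconst.
Proof.
move=> a b; rewrite /qconst -qpiN -qpiD; apply: qpi_qeq; apply: qeq_sym.
by rewrite qeq_oppE qeq_constM mulN1r; apply: qeq_constD.
Qed.

Lemma qconst_is_monoid_morphism : monoid_morphism qconst.
Proof.
split=> // a b; rewrite /qconst -qpiM; apply: qpi_qeq; apply: qeq_sym.
exact: qeq_constM.
Qed.

HB.instance Definition _ :=
  GRing.isZmodMorphism.Build F (qquot I) qconst qconst_is_zmod_morphism.
HB.instance Definition _ :=
  GRing.isMonoidMorphism.Build F (qquot I) qconst qconst_is_monoid_morphism.

Definition qcvar (x : 'I_#|{: idx}|) : qquot I :=
  let: (k, a, b) := enum_val x in qpi I (QCVar (val k) a b).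

Lemma qconst_comm a x : GRing.comm (qconst a) x.
Proof.
rewrite -(qrepK x) /GRing.comm -!qpiM; apply: qpi_qeq; exact: qeq_const_central.
Qed.

Lemma qcvar_comm i x : GRing.comm x (qcvar i).
Proof.
rewrite -(qrepK x) /GRing.comm /qcvar; case: (enum_val i) => [[k a] b].
rewrite -!qpiM; apply: qpi_qeq; apply: qeq_sym; exact: qeq_cvar_central.
Qed.

Definition qscal (c : C) : qquot I := mmap qconst qcvar c.

Lemma qscal_is_zmod_morphism : zmod_morphism qscal.
Proof. exact: mmap_is_additive. Qed.

Lemma qscal_is_monoid_morphism : monoid_morphism qscal.
Proof.
have [HM H1] : multiplicative qscal.
  by apply: commr_mmap_is_multiplicative => *; [apply: qcvar_comm | apply: qconst_comm].
by split.
Qed.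

HB.instance Definition _ :=
  GRing.isZmodMorphism.Build C (qquot I) qscal qscal_is_zmod_morphism.
HB.instance Definition _ :=
  GRing.isMonoidMorphism.Build C (qquot I) qscal qscal_is_monoid_morphism.

Lemma qscalC c x : qscal c * x = x * qscal c.
Proof.
rewrite /qscal /mmap mulr_suml mulr_sumr; apply: eq_bigr => m _.
have HM : x * mmap1 qcvar m = mmap1 qcvar m * x.
  by apply: commr_prod => i _; apply/commrX/qcvar_comm.
by rewrite -mulrA -HM !mulrA qconst_comm.
Qed.

Lemma qpi_Phi p i j : vars_below p -> qpi I (Phi p i j) = qscal (gmat p i j).
Proof.
elim: p i j => [a|k a b|k|p IHp q IHq|p IHp q IHq|p IHp] i j.
- move=> _; rewrite [RHS]/= mxE /=.
  case: eqP => _; last by rewrite mulr0n rmorph0.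
  by rewrite mulr1n /qscal mmapC.
- move=> /= Hk; rewrite mxE; case: eqP => _; last by rewrite mulr0n rmorph0.
  rewrite mulr1n -[k]/(val (Ordinal Hk)) gvar_ord /qscal mmapX mmap1U.
  by rewrite /qcvar enum_rankK.
- move=> /= Hk; rewrite mxE -[k]/(val (Ordinal Hk)) gvar_ord /qscal mmapX mmap1U.
  by rewrite /qcvar enum_rankK.
- by move=> /= /andP[Hp Hq]; rewrite mxE rmorphD qpiD IHp // IHq.
- move=> /= /andP[Hp Hq]; rewrite mxE rmorph_sum qpi_sum big_map big_enum /=.
  by apply: eq_bigr => l _; rewrite qpiM rmorphM IHp // IHq.
- by move=> /= Hp; rewrite mxE rmorphN qpiN IHp.
Qed.

End ScalarMorphism.

(** * The Cayley-Hamilton identity in the quotient *)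

Section CayleyHamilton.
Variables (F : fieldType) (n K : nat).
Local Notation qp := (quasipoly F n).
Local Notation idx := ('I_K * 'I_n * 'I_n)%type.
Local Notation C := {mpoly F[#|{: idx}|]}.
Local Notation gmat := (@gmat F n K).
Local Notation vars_below := (@vars_below F n K).
Local Notation qscal I := (@qscal F n K I).

Lemma vars_below_Phi p i j : vars_below p -> vars_below (Phi p i j).
Proof.
elim: p i j => [a|k a b|k|p IHp q IHq|p IHp q IHq|p IHp] i j //=.
- by case: eqP.
- by case: eqP.
- by move=> /andP[/IHp -> /IHq ->].
- move=> /andP[Hp Hq]; rewrite vars_below_qsum; apply/allP => x /mapP[l _ ->] /=.
  by rewrite IHp // IHq.
- exact: IHp.
Qed.

Lemma gmat_Phi p i j : gmat (Phi p i j) = (gmat p i j)%:M.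
Proof.
elim: p i j => [a|k a b|k|p IHp q IHq|p IHp q IHq|p IHp] i j /=.
- by rewrite mxE; case: eqP => _ //=; rewrite mpolyC0.
- by rewrite mxE; case: eqP => _ //=; rewrite mpolyC0.
- by rewrite mxE.
- by rewrite IHp IHq mxE raddfD.
- rewrite gmat_qsum big_map big_enum mxE raddf_sum /=.
  by apply: eq_bigr => l _; rewrite IHp IHq scalar_mxM.
- by rewrite IHp mxE raddfN.
Qed.

(** An entry of [Phi] represents c for all ideals at once, which allows scalars in two different
    quotients to be compared. *)
Lemma qscal_repr (c : C) : (0 < n)%N -> exists p,
  [/\ vars_below p, gmat p = c%:M & forall I, qpi I p = qscal I c].
Proof.
move=> n_gt0; pose i0 := Ordinal n_gt0; have [p Hp Hpc] := in_gmatC c.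
exists (Phi p i0 i0); split; first exact: vars_below_Phi.
  by rewrite gmat_Phi Hpc mxE eqxx.
by move=> I; rewrite (qpi_Phi I i0 i0 Hp) Hpc mxE eqxx.
Qed.

Lemma qsubst_qsum H (s : seq qp) : qsubst H (qsum s) = qsum [seq qsubst H p | p <- s].
Proof. by elim: s => //= p s ->. Qed.

Lemma qsubst_qprod H (s : seq qp) : qsubst H (qprod s) = qprod [seq qsubst H p | p <- s].
Proof. by elim: s => //= p s ->. Qed.

Lemma qsubst_word (p : qp) w :
  qsubst (fun=> p) (qprod (map (@varof F n) w)) = qprod (nseq (size w) p).
Proof. by elim: w => //= i w ->. Qed.

Lemma qsubst_Phi_word (p : qp) w i j :
  qsubst (fun=> p) (Phi (qprod (map (@varof F n) w)) i j) =
  Phi (qprod (nseq (size w) p)) i j.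
Proof.
elim: w i j => [|k w IH] i j /=; first by case: eqP.
rewrite qsubst_qsum -map_comp; congr qsum; apply: eq_map => l /=.
by rewrite IH.
Qed.

Variable I : qideal F n.
Hypothesis inTQ_I : forall p, inTQ p -> I p.

Lemma vars_below_nseq p m : vars_below p -> vars_below (qprod (nseq m p)).
Proof. by move=> Hp; elim: m => //= m ->; rewrite Hp. Qed.

Lemma gmat_nseq p m : gmat (qprod (nseq m p)) = gmat p ^+ m.
Proof. by elim: m => [|m IH] /=; rewrite ?mpolyC1 // exprS IH. Qed.

Lemma qpi_qsubst_qtr p w : vars_below p ->
  qpi I (qsubst (fun=> p) (qtr (qprod (map (@varof F n) w)))) =
  qscal I (\tr (gmat p ^+ size w)).
Proof.
move=> Hp; rewrite /qtr qsubst_qsum -map_comp qpi_sum big_map big_enum /=.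
rewrite /mxtrace rmorph_sum; apply: eq_bigr => i _.
by rewrite qsubst_Phi_word (qpi_Phi I i i (vars_below_nseq _ Hp)) gmat_nseq.
Qed.

(** Substitute p for every variable of [Qn] and group the permutations by the number k of letters
    accompanying n+1 in its cycle. *)
Lemma quot_CayleyHamilton p : vars_below p ->
  \sum_(k < n.+1) qscal I (chc (gmat p) k) * qpi I p ^+ k = 0.
Proof.
move=> Hp; have /inTQ_I/qpi_eq0 Hsub := inTQ_subst (fun=> p) (inTQ_gen F n); rewrite -[RHS]Hsub.
rewrite /Qn qsubst_qsum -map_comp qpi_sum big_map big_enum /=.
have Hk (s : 'S_n.+1) : (#|porbit s ord_max|.-1 < n.+1)%N.
  by rewrite prednK ?card_porbit_gt0 // card_porbit_le.
rewrite [RHS](partition_big (fun s => Ordinal (Hk s)) predT) //=.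
apply: eq_bigr => k _; rewrite /chc rmorph_sum mulr_suml; apply: eq_big => [s|s].
  by rewrite -val_eqE.
rewrite -?val_eqE /= => /eqP Hs; rewrite !qpiM rmorphM -mulrA; congr (_ * _).
  by rewrite rmorphXn rmorphN1 -[RHS]/(qconst I _) rmorphXn rmorphN1.
rewrite qsubst_qprod -map_comp qpi_prod big_map big_filter /=.
have -> : \prod_(i | cyc_leader s i) \tr (gmat p ^+ #|porbit s i|) =
    \prod_(i <- enum 'I_n.+1 | cyc_leader s i) \tr (gmat p ^+ #|porbit s i|).
  by rewrite big_enum_cond.
rewrite rmorph_prod; congr (_ * _).
  by apply: eq_bigr => i _; rewrite qpi_qsubst_qtr // /cyc_word size_traject.
rewrite qsubst_word size_behead size_traject Hs qpi_prod big_nseq.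
by elim: (k : nat) => //= m IH; rewrite exprS IH.
Qed.

Definition qrel (a : qquot I) (M : 'M[C]_n) : Prop :=
  exists p, [/\ vars_below p, qpi I p = a & gmat p = M].

Lemma qrelD a b M N : qrel a M -> qrel b N -> qrel (a + b) (M + N).
Proof.
move=> [p [Hp <- <-]] [q [Hq <- <-]]; exists (QAdd p q).
by split; rewrite ?qpiD //= Hp.
Qed.

Lemma qrelM a b M N : qrel a M -> qrel b N -> qrel (a * b) (M *m N).
Proof.
move=> [p [Hp <- <-]] [q [Hq <- <-]]; exists (QMul p q).
by split; rewrite ?qpiM //= Hp.
Qed.

Lemma qrelC c : (0 < n)%N -> qrel (qscal I c) c%:M.
Proof. by move=> /(qscal_repr c)[p [H1 H2 H3]]; exists p. Qed.

Lemma qrel_CH a M : qrel a M -> \sum_(k < n.+1) qscal I (chc M k) * a ^+ k = 0.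
Proof. by move=> [p [Hp <- <-]]; apply: quot_CayleyHamilton. Qed.

End CayleyHamilton.

Lemma exists_vars_below (F : fieldType) (n : nat) (p : quasipoly F n) :
  exists K0, forall K, (K0 <= K)%N -> vars_below K p.
Proof.
elim: p => [a|k a b|k|p [K1 H1] q [K2 H2]|p [K1 H1] q [K2 H2]|p //].
- by exists 0%N.
- by exists k.+1.
- by exists k.+1.
- by exists (maxn K1 K2) => K; rewrite geq_max => /andP[/H1 /= -> /H2 ->].
- by exists (maxn K1 K2) => K; rewrite geq_max => /andP[/H1 /= -> /H2 ->].
Qed.

(** * The ideal of elements killed by a power of a scalar *)

Section Torsion.
Variables (F : fieldType) (n K : nat) (I0 : qideal F n).
Local Notation C := {mpoly F[#|{: 'I_K * 'I_n * 'I_n}|]}.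
Variable g : C.

Definition torsion (p : quasipoly F n) : Prop :=
  exists m, qscal I0 g ^+ m * qpi I0 p = 0.

Hypothesis torsion_proper : ~ torsion (QConst 1).

Lemma torsion_qeq p q : qeq p q -> torsion p -> torsion q.
Proof. by move=> /(qpi_qeq I0) H [m Hm]; exists m; rewrite -H. Qed.

Lemma torsion_zero : torsion (QConst 0).
Proof. by exists 0%N; rewrite qpi0 mulr0. Qed.

Lemma torsion_add p q : torsion p -> torsion q -> torsion (QAdd p q).
Proof.
move=> [m Hm] [l Hl]; exists (m + l)%N; rewrite qpiD mulrDr {1}addnC !exprD.
by rewrite -!mulrA Hm Hl !mulr0 addr0.
Qed.

Lemma torsion_mull r p : torsion p -> torsion (QMul r p).
Proof.
move=> [m Hm]; exists m; rewrite qpiM -rmorphXn mulrA qscalC -mulrA rmorphXn.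
by rewrite Hm mulr0.
Qed.

Lemma torsion_mulr r p : torsion p -> torsion (QMul p r).
Proof. by move=> [m Hm]; exists m; rewrite qpiM mulrA Hm mul0r. Qed.

Definition torsion_ideal : qideal F n :=
  QIdeal torsion_qeq torsion_zero torsion_add torsion_mull torsion_mulr
    torsion_proper.

End Torsion.

(** * Passage to the torsion-free quotient and back to powers of c *)

Theorem mainTheorem6 (F : fieldType) (n : nat) (P c : quasipoly F n) :
  (GRing.pchar F) =i pred0 -> (0 < n)%N ->
  quasi_identity P ->
  central_poly c -> const_term c = 0 ->
  exists m : nat, inTQ (QMul (qpow c m) P).
Proof.
move=> pchar0 n_gt0 HP Hc Hc0.
(* If 1 lies in the T-ideal the claim is trivial; otherwise the T-ideal is proper and has a
   quotient. *)
have [inTQ1|inTQ_proper] := boolp.pselect (inTQ (QConst 1 : quasipoly F n)).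
  by exists 0%N; apply: inTQ_mulr.
pose I0 : qideal F n := QIdeal (@inTQ_eq F n) (@inTQ_zero F n) (@inTQ_add F n)
  (@inTQ_mull F n) (@inTQ_mulr F n) inTQ_proper.
have [K [PK cK]] : exists K, vars_below K P /\ vars_below K c.
  have [K1 H1] := exists_vars_below P; have [K2 H2] := exists_vars_below c.
  by exists (maxn K1 K2); rewrite H1 ?H2 ?leq_maxl ?leq_maxr.
pose i0 : 'I_n := Ordinal n_gt0; pose g := gmat K c i0 i0.
have gP : gmat K P = 0 := gmat_quasi_identity K pchar0 HP.
have gc : gmat K c = g%:M := gmat_central K pchar0 i0 Hc.
have [m Hm] : exists m, qscal I0 g ^+ m * qpi I0 P = 0.
  (* If 1 is torsion, a power of g is already 0 modulo the T-ideal; otherwise the torsion ideal is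
     proper. *)
  have [[m Hm]|proper1] := boolp.pselect (torsion I0 g (QConst 1)).
    by exists m; rewrite -[_ ^+ m]mulr1 Hm mul0r.
  pose I1 := torsion_ideal proper1.
  have inTQ_I1 p : inTQ p -> I1 p.
    by move=> Hp; exists 0%N; rewrite expr0 mul1r; apply/qpi_eq0.
  have [m0 Hm0] := rad_conductor_central pchar0 n_gt0 i0 Hc Hc0 cK.
  (* An element that becomes torsion after multiplication by g^m0 was torsion before: the exponents
     add. *)
  have regular a : qscal I1 (g ^+ m0) * a = 0 -> a = 0.
    have [r [_ _ Hr]] := qscal_repr (g ^+ m0) n_gt0.
    rewrite -(qrepK a) -Hr -qpiM => /qpi_eq0[m Hm]; apply/qpi_eq0.
    exists (m + m0)%N; have H0 : qscal I0 g ^+ m0 = qpi I0 r by rewrite Hr rmorphXn.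
    by rewrite exprD H0 -mulrA -qpiM.
  have /fin_all_exists[e He] : forall i : 'I_n, exists ei : 'I_n -> qquot I1,
      forall j, qrel (ei j) (g ^+ m0 *: delta_mx i j).
    move=> i; apply: (@fin_all_exists _ (fun=> qquot I1)
      (fun j a => qrel a (g ^+ m0 *: delta_mx i j))) => j.
    by have [p Hp Hpe] := Hm0 (delta_mx i j); exists (qpi I1 p), p.
  have /qpi_eq0 : qpi I1 P = 0; last exact.
  apply: (Rel_kernel_trivial (@mpolyC _ F) (iota := qscal I1)
    (Rel := @qrel F n K I1) pchar0 _ _ _ _ _ regular He n_gt0) => //.
  - exact: qscalC.
  - exact: qrelD.
  - exact: qrelM.
  - by move=> d; apply: qrelC.
  - exact: qrel_CH.
  - by exists P.
pose x := qpi I0 c - qscal I0 g.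
have Hx : x ^+ n = 0.
  have [r [Hr1 Hr2 Hr3]] := qscal_repr g n_gt0.
  apply: (Rel0_nil (@mpolyC _ F) (iota := qscal I0) (Rel := @qrel F n K I0)) => //.
    exact: qrel_CH.
  exists (QAdd c (QOpp r)); split; first by rewrite /= cK.
    by rewrite qpiD qpiN Hr3.
  by rewrite /= gc Hr2 subrr.
(* In the expansion of (x + g)^(n+m) each term has at least m factors g, which kill P, or at least n
   factors x, which give 0. *)
exists (n + m)%N; apply/(qpi_eq0 I0); rewrite qpiM qpi_pow.
have -> : qpi I0 c = x + qscal I0 g by rewrite subrK.
rewrite exprDn_comm; last by rewrite /GRing.comm qscalC.
rewrite mulr_suml big1 // => i _; rewrite mulrnAl.
case: (leqP m i) => Hi.
  by rewrite -(subnK Hi) exprD -!mulrA Hm !mulr0 mul0rn.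
have Hn : (n <= n + m - i)%N by rewrite -addnBA ?leq_addr // ltnW.
by rewrite -(subnK Hn) exprD Hx mulr0 !mul0r mul0rn.
Qed.
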